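(* Assume (TPC). If $\mathcal V$ is continuous on $\partial\mathcal T$, then $\mathcal V$ is continuous in its domain $Dom(\mathcal V)$ and $\lim_{x\to\bar x}\mathcal V(x)=+\infty$ for every $\bar x\in\partial Dom(\mathcal V)$.
   Context: Standing setting. $A\subset\mathbb R^m$ is compact; the target $\mathcal T\subset\mathbb R^n$ is closed with compact boundary; $\mathcal T^c=\mathbb R^n\setminus\mathcal T$, $\overset{\circ}{\mathcal T}$ is the interior of $\mathcal T$, $\mathbf d(x)=\mathrm{dist}(x,\mathcal T)$, $\mathbb R_+=[0,+\infty[$. For $\delta>0$, $\mathcal T_\delta=\overline{B(\mathcal T,\delta)}$ is the closed $\delta$-neighbourhood of $\mathcal T$ and $\mathcal T_\delta^c=\mathbb R^n\setminus\mathcal T_\delta$. The functions $f:\mathbb R^n\times A\to\mathbb R^n$ and $l:\mathbb R^n\times A\to\mathbb R_+$ are continuous; there is $M>0$ with $|f(x,a)|\le M(1+|x|)$ for all $(x,a)$, and for every $R>0$ there is $L_R>0$ with $|f(x_1,a)-f(x_2,a)|\le L_R|x_1-x_2|$ and $|l(x_1,a)-l(x_2,a)|\le L_R|x_1-x_2|$ whenever $|x_1|,|x_2|\le R$, $a\in A$. $\mathcal A$ is the set of measurable controls $\alpha:\mathbb R_+\to A$, and $y_x(\cdot,\alpha)$ is the solution on $\mathbb R_+$ of $\dot y(t)=f(y(t),\alpha(t))$, $y(0)=x$. Put $t_x(\alpha)=\inf\{t\ge0: y_x(t,\alpha)\in\mathcal T\}\le+\infty$ and $\mathcal A(x)=\{\alpha\in\mathcal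 A:\ \liminf_{t\to t_x(\alpha)^-}\mathbf d(y_x(t,\alpha))=0\}$. For $x\in\mathcal T^c$, $\mathcal V(x)=\inf_{\alpha\in\mathcal A(x)}\int_0^{t_x(\alpha)}l(y_x(t,\alpha),\alpha(t))\,dt$ (with $\inf\emptyset=+\infty$); $\mathcal V=0$ on $\mathcal T$. ''Continuous on $\partial\mathcal T$'' means continuous at each point of $\partial\mathcal T$ as a function on $\mathbb R^n\setminus\overset{\circ}{\mathcal T}$. $Dom(\mathcal V)=\{x\in\mathbb R^n\setminus\overset{\circ}{\mathcal T}:\mathcal V(x)<+\infty\}$, and $\partial Dom(\mathcal V)$ is its boundary relative to $\mathbb R^n\setminus\overset{\circ}{\mathcal T}$. (TPC): for all $R,\eta,\delta>0$ there exists an increasing function $T(\cdot):\mathbb R_+\to\mathbb R_+$ such that for every $x\in\mathcal T_\delta^c\cap Dom(\mathcal V)$ with $\mathbf d(x)\le R$ there is a control $\alpha\in\mathcal A(x)$ verifying $\int_0^{t_x(\alpha)}l(y_x(t,\alpha),\alpha(t))\,dt\le\mathcal V(x)+\eta$ and $t_x^\delta(\alpha):=\inf\{t>0: y_x(t,\alpha)\in\mathcal T_\delta\}\le T(\mathcal V(x))$. *)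

(* Defs.v *)
From HB Require Import structures.
From mathcomp Require Import all_boot all_order all_algebra.
From mathcomp Require Import all_classical all_reals all_analysis.

Set Implicit Arguments.
Unset Strict Implicit.
Unset Printing Implicit Defensive.

Import Order.TTheory GRing.Theory Num.Theory.
Import numFieldNormedType.Exports.

Local Open Scope classical_set_scope.
Local Open Scope ring_scope.

(* The canonical measurable structure on [R] is the Borel one. Controls are
   Lebesgue measurable, so we use the completed (Caratheodory) sigma-algebra,
   which lives on an alias of [R]. *)
Definition lebesgueR (R : realType) : measurableType _ :=
  caratheodory_type ((@wlength R idfun)^*)%mu.

Notation leb := (@completed_lebesgue_measure _).

(* [R^m] with its Borel sigma-algebra. *)
Definition borel_rV (R : realType) (m : nat) : measurableType _ :=
  g_sigma_algebraType (@open 'rV[R]_m).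

(* The library norm [`|x|] on ['rV_n] is the sup norm; the topology of ['rV_n]
   is the usual one. *)
Definition enorm {R : realType} {n : nat} (x : 'rV[R]_n) : R :=
  Num.sqrt (\sum_i (x ord0 i) ^+ 2).

Definition boundary {X : topologicalType} (S : set X) : set X :=
  closure S `\` S°.

(* Boundary of [D] in the subspace [E], for [D `<=` E]. *)
Definition rel_boundary {X : topologicalType} (E D : set X) : set X :=
  E `&` closure D `&` closure (E `\` D).

Section target.
Context {R : realType} {n : nat}.
Implicit Types (T : set 'rV[R]_n) (z : R -> 'rV[R]_n).

(* Extended real, so that the distance to the empty set is [+oo]. *)
Definition dist T (x : 'rV[R]_n) : \bar R :=
  ereal_inf [set (enorm (x - w))%:E | w in T].

Definition nbhd T (delta : R) : set 'rV[R]_n :=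
  closure [set x | (dist T x < delta%:E)%E].

Definition outside T : set 'rV[R]_n := ~` T°.

Definition hit_time T z : \bar R :=
  ereal_inf [set t%:E | t in [set t : R | 0 <= t /\ T (z t)]].

Definition nbhd_time T (delta : R) z : \bar R :=
  ereal_inf [set t%:E | t in [set t : R | 0 < t /\ nbhd T delta (z t)]].

End target.

(* The filter of [s -> t^-], for [t] possibly [+oo]. *)
Definition left_filter {R : realType} (t : \bar R) : set_system R :=
  match t with
  | r%:E => r^'-
  | +oo%E => +oo_R
  | -oo%E => -oo_R
  end.

Section control.
Context {R : realType} {n m : nat}.
Variables (T : set 'rV[R]_n) (A : set 'rV[R]_m).
Variables (f : 'rV[R]_n -> 'rV[R]_m -> 'rV[R]_n).
Variables (l : 'rV[R]_n -> 'rV[R]_m -> R).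

(* Only the restriction of a control to [0, +oo[ is meaningful. *)
Definition control (a : R -> 'rV[R]_m) : Prop :=
  (forall t, 0 <= t -> A (a t)) /\
  @measurable_fun _ _ (lebesgueR R) (borel_rV R m) `[0, +oo[ a.

(* Caratheodory solution on [0, +oo[ of z' = f(z, a), z(0) = x, in integral
   form. *)
Definition is_solution (x : 'rV[R]_n) (a : R -> 'rV[R]_m) (z : R -> 'rV[R]_n)
    : Prop :=
  forall t, 0 <= t ->
    (forall i, leb.-integrable `[0, t]
                 (fun s : lebesgueR R => (f (z s) (a s) ord0 i)%:E)) /\
    z t = x + \row_i \int[leb]_(s in `[0, t]) f (z s) (a s) ord0 i.

(* [y x a] is the trajectory starting at [x] with control [a]. *)
Variable y : 'rV[R]_n -> (R -> 'rV[R]_m) -> R -> 'rV[R]_n.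

Definition admissible (x : 'rV[R]_n) : set (R -> 'rV[R]_m) :=
  [set a | control a /\
     limf_einf (fun t => dist T (y x a t)) (left_filter (hit_time T (y x a)))
     = 0%E].

Definition cost (x : 'rV[R]_n) (a : R -> 'rV[R]_m) : \bar R :=
  (\int[leb]_(t in [set t : lebesgueR R |
                     (0 <= t)%R /\ (t%:E < hit_time T (y x a))%E])
     (l (y x a t) (a t))%:E)%E.

Definition value (x : 'rV[R]_n) : \bar R :=
  if x \in T then 0%E else ereal_inf [set cost x a | a in admissible x].

Definition Dom : set 'rV[R]_n :=
  [set x | outside T x /\ (value x < +oo)%E].

(* Continuity at [x] of [value] as a function on [outside T]; values are in
   [\bar R] with its order topology. *)
Definition value_continuous_at (x : 'rV[R]_n) : Prop :=
  value @ within (outside T) (nbhs x) --> value x.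

Definition TPC : Prop :=
  forall Rad eta delta : R, 0 < Rad -> 0 < eta -> 0 < delta ->
  exists tau : R -> R,
    [/\ forall s, 0 <= s -> 0 <= tau s,
        forall s t, 0 <= s -> s <= t -> tau s <= tau t &
        forall x, ~ nbhd T delta x -> Dom x -> (dist T x <= Rad%:E)%E ->
          exists a, [/\ admissible x a,
                        (cost x a <= value x + eta%:E)%E &
                        (nbhd_time T delta (y x a)
                           <= (tau (fine (value x)))%:E)%E]].

End control.

(* Main.v *)
(** The value is bounded uniformly near a point outside the target as soon as it
    is bounded at one nearby point.  Fix [xbar] outside [T] and let [x1], [x2] be
    close to [xbar] with [V x1 <= K].  (TPC) gives an almost optimal control for
    [x1] whose trajectory enters a thin neighbourhood of [T] before the time
    [tau K], which does not depend on [x1].  On this bounded time interval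
    Grönwall's inequality keeps the trajectory of [x2] under the same control
    close to that of [x1], hence the running costs are close and the second
    trajectory ends near [T] as well (or has already hit it).  Compactness of the
    boundary and continuity of [V] there make the remaining cost small, and
    concatenating controls yields [V x2 <= V x1 + eps].  Exchanging [x1] and [x2]
    gives continuity on the domain; near a boundary point of the domain [V]
    cannot stay below any [K], for otherwise [V] would be finite on a whole
    neighbourhood. *)

Require Import Defs.
From HB Require Import structures.
From mathcomp Require Import all_boot all_order all_algebra.
From mathcomp Require Import all_classical all_reals all_analysis.
From mathcomp Require Import measurable_realfun ring lra.

Set Implicit Arguments.
Unset Strict Implicit.
Unset Printing Implicit Defensive.

Import Order.TTheory GRing.Theory Num.Theory.
Import numFieldNormedType.Exports.

Local Open Scope classical_set_scope.
Local Open Scope ring_scope.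

(** * Translation invariance of the completed Lebesgue measure *)

Section translation.
Context {R : realType}.
Implicit Types (c : R) (X Y : set R).

Lemma preimage_shift_itvoc c (a b : R) :
  shift c @^-1` `]a, b] = `]a - c, b - c]%classic.
Proof.
by apply/seteqP; split=> x; rewrite /shift/= !in_itv/= ltrBlDr lerBrDr.
Qed.

(** A cover of [X] by half-open intervals pulls back under the shift to a cover by intervals of the
    same lengths. *)
Lemma outer_shift_le c X :
  (((wlength idfun)^* (shift c @^-1` X))%mu
    <= ((wlength idfun)^* X)%mu)%E.
Proof.
apply: le_ereal_inf_tmp => _ [F [mF XF] <-].
apply: ereal_inf_lbound; exists (fun k => shift c @^-1` (F k)).
  split=> [k|x /= /XF [k _ Fk]]; last by exists k.
  by have [[a b] _ <-] := mF k; rewrite /= preimage_shift_itvoc; exists (a - c, b - c).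
apply: eq_eseriesr => k _; have [[a b] _ <-] := mF k.
rewrite /= preimage_shift_itvoc !wlength_itv /= !lte_fin ltrD2r.
by case: ifP => // _; rewrite -!EFinB opprB addrA addrNK.
Qed.

Lemma outer_shift c X :
  ((wlength idfun)^* (shift c @^-1` X))%mu
    = ((wlength idfun)^* X)%mu.
Proof.
apply/eqP; rewrite eq_le outer_shift_le/=.
have {1}-> : X = shift (- c) @^-1` (shift c @^-1` X).
  by apply/seteqP; split=> x /=; rewrite subrK.
exact: outer_shift_le.
Qed.

(** Testing the preimage on [Y] amounts to testing [X] on a translate of [Y], by invariance of the
    outer measure. *)
Lemma caratheodory_shift c X :
  (((wlength idfun)^*)%mu : set R -> \bar R).-caratheodory X ->
  (((wlength idfun)^*)%mu : set R -> \bar R).-caratheodory (shift c @^-1` X).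
Proof.
move=> mX Y; have := mX (shift (- c) @^-1` Y).
rewrite -(outer_shift c (_ @^-1` Y)) -(outer_shift c (_ `&` X)).
rewrite -(outer_shift c (_ `&` ~` X)) !preimage_setI preimage_setC.
have -> // : shift c @^-1` (shift (- c) @^-1` Y) = Y.
by apply/seteqP; split=> x; rewrite /shift /= addrK.
Qed.

Lemma measurable_shift c :
  measurable_fun setT (shift c : lebesgueR R -> lebesgueR R).
Proof. by move=> _ X mX; rewrite setTI; exact: caratheodory_shift. Qed.

Lemma measurable_fun_shift c d (U : sigmaRingType d) (D : set (lebesgueR R))
    (g : lebesgueR R -> U) : measurable D -> measurable_fun D g ->
  measurable_fun (shift c @^-1` D : set (lebesgueR R)) (g \o shift c).
Proof. by move=> mD mg _ Y mY; exact: caratheodory_shift (mg mD Y mY). Qed.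

Lemma leb_shift c X : leb (shift c @^-1` X) = leb X.
Proof. exact: outer_shift. Qed.

(** Change of variables through the pushforward: by [leb_shift] the image of [leb] under a shift is
    [leb] itself. *)
Lemma ge0_integral_shift c (D : set (lebesgueR R)) (f : lebesgueR R -> \bar R) :
  measurable D -> measurable_fun D f -> (forall x, D x -> 0 <= f x)%E ->
  (\int[leb]_(x in D) f x
   = \int[leb]_(x in (shift c @^-1` D : set (lebesgueR R))) f (x + c)%R)%E.
Proof.
move=> mD mf f0.
have := @ge0_integral_pushforward _ _ _ _ R _ (measurable_shift c) leb D f mD mf.
move=> <-; last by move=> x /set_mem/f0.
apply: eq_measure_integral => [|? A _ _]; first exact: measurable_shift.
exact/esym/leb_shift.
Qed.

Lemma integral_shift c (D : set (lebesgueR R)) (f : lebesgueR R -> \bar R) :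
  measurable D -> measurable_fun D f ->
  (\int[leb]_(x in D) f x
   = \int[leb]_(x in (shift c @^-1` D : set (lebesgueR R))) f (x + c)%R)%E.
Proof.
move=> mD mf; rewrite integralE [RHS]integralE.
rewrite (@ge0_integral_shift c _ (f^\+)%E)//; last exact: measurable_funepos.
rewrite (@ge0_integral_shift c _ (f^\-)%E)//; last exact: measurable_funeneg.
by congr (_ - _)%E; apply: eq_integral => x _; rewrite ?funeposE ?funenegE.
Qed.

Lemma measurable_leb_itv (i : interval R) :
  measurable ([set` i] : set (lebesgueR R)).
Proof.
apply: sub_caratheodory.
exact: (@measurable_itv R).
Qed.

Lemma leb_itv (s t : R) b0 b1 : s <= t ->
  leb [set` Interval (BSide b0 s) (BSide b1 t)] = (t - s)%:E.
Proof.
move=> st.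
have -> : leb [set` Interval (BSide b0 s) (BSide b1 t)] =
  lebesgue_measure [set` Interval (BSide b0 s) (BSide b1 t)] by [].
rewrite lebesgue_measure_itv/= lte_fin -EFinB; case: ltgtP st => // -> _.
by rewrite subrr.
Qed.

End translation.

(** * Grönwall's inequality *)

Section gronwall.
Context {R : realType}.

(* Grönwall's inequality without the exponential: on an interval of length
   [1 / (2 K)] the hypothesis gives [sup u <= u s + (sup u) / 2]. *)
Lemma gronwall_doubling (u : R -> R) (K tau C : R) :
  0 <= K -> (forall t, 0 <= u t) ->
  (forall t, 0 <= t <= tau -> u t <= C) ->
  (forall s t B, 0 <= s -> s <= t -> t <= tau ->
     (forall r, s < r <= t -> u r <= B) -> u t <= u s + K * (t - s) * B) ->
  forall k t, 0 <= t <= tau -> K * t <= k%:R / 2 -> u t <= 2 ^+ k * u 0.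
Proof.
move=> K0 u0 uC uH; elim=> [|k IH] t /andP[t0 tt] Kt.
  (* Here [K * t <= 0], so the term multiplied by [C] vanishes. *)
  have := uH 0 t C (lexx _) t0 tt _.
  have -> : K * (t - 0) = 0.
    by rewrite subr0; apply/eqP; rewrite eq_le mulr_ge0 ?andbT// (le_trans Kt)// mul0r.
  rewrite mul0r addr0 expr0 mul1r => H; apply: H => r /andP[r0 rt]; apply: uC.
  by rewrite (ltW r0) (le_trans rt).
have [Ktk|Ktk] := leP (K * t) (k%:R / 2).
  have tk : u t <= 2 ^+ k * u 0 by apply: IH => //; rewrite t0 tt.
  by apply: (le_trans tk); rewrite ler_wpM2r// ler_eXn2l// ltr1n.
have Kgt0 : 0 < K.
  rewrite lt_neqAle K0 andbT; apply: contraTneq Ktk => <-.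
  by rewrite mul0r -leNgt divr_ge0.
(* The induction hypothesis reaches exactly the time [s], and [K * (t - s) <= 1 / 2] remains. *)
pose s : R := k%:R / 2 / K.
have Ks : K * s = k%:R / 2 by rewrite /s mulrC divfK// gt_eqF.
have s0 : 0 <= s by rewrite !divr_ge0.
have st : s < t by rewrite -(ltr_pM2l Kgt0) Ks.
have us : u s <= 2 ^+ k * u 0.
  by apply: IH; rewrite ?Ks// s0 (le_trans (ltW st)).
suff : u t <= 2 * u s by rewrite exprS; move: us; lra.
pose E : set R := [set u r | r in `]s, t]].
(* The a priori bound [C] makes the supremum finite, so that half of it can be absorbed. *)
have Eub : has_ubound E.
  exists C => y [r]; rewrite /= in_itv/= => /andP[sr rt] <-; apply: uC.
  by rewrite (le_trans s0 (ltW sr)) (le_trans rt).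
have uE r : s < r <= t -> u r <= sup E.
  by move=> srt; apply: ub_le_sup => //; exists r => //=; rewrite in_itv.
have ut : u t <= sup E by apply: uE; rewrite st lexx.
have half r : s < r <= t -> u r <= u s + 1 / 2 * sup E.
  move=> /andP[sr rt]; apply: (le_trans (uH s r (sup E) s0 (ltW sr) _ _)).
  - exact: le_trans rt tt.
  - by move=> q /andP[sq qr]; apply: uE; rewrite sq (le_trans qr).
  - rewrite lerD2l ler_wpM2r ?(le_trans _ ut)//.
    have : K * r <= K * t by rewrite ler_wpM2l.
    by move: Kt; rewrite mulrBr Ks -natr1; lra.
have : sup E <= u s + 1 / 2 * sup E.
  apply: ge_sup; first by exists (u t), t => //=; rewrite in_itv/= st lexx.
  by move=> y [r]; rewrite /= in_itv/= => srt <-; apply: half.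
by move: ut; lra.
Qed.

End gronwall.

(** * Comparison of the Euclidean, sup and l1 norms *)

Section norms.
Context {R : realType} {n : nat}.
Implicit Types x : 'rV[R]_n.

(** Trajectories are estimated coordinate by coordinate and the bounds are then summed, which makes
    this norm the convenient one. The comparisons below transfer the results to [enorm] and to the
    sup norm of the topology. *)
Definition l1norm x : R := \sum_i `|x ord0 i|.

Lemma l1norm_ge0 x : 0 <= l1norm x.
Proof. exact: sumr_ge0. Qed.

Lemma enorm_ge0 x : 0 <= enorm x. Proof. exact: sqrtr_ge0. Qed.

Lemma coord_le_enorm x i : `|x ord0 i| <= enorm x.
Proof.
rewrite /enorm -sqrtr_sqr ler_sqrt ?sumr_ge0// => [|j _]; last exact: sqr_ge0.
by rewrite (bigD1 i)//= lerDl sumr_ge0// => j _; exact: sqr_ge0.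
Qed.

(** In each square, one factor is bounded by the whole sum of the absolute values. *)
Lemma enorm_le_l1norm x : enorm x <= l1norm x.
Proof.
rewrite /enorm -(ger0_norm (l1norm_ge0 x)) -sqrtr_sqr ler_sqrt ?sqr_ge0//.
rewrite expr2 /l1norm mulr_suml ler_sum// => i _.
rewrite -[leLHS]real_normK ?num_real// expr2 ler_wpM2l//.
by rewrite (bigD1 i)//= lerDl sumr_ge0.
Qed.

Lemma l1norm_le_const x (C : R) : (forall i, `|x ord0 i| <= C) ->
  l1norm x <= n%:R * C.
Proof.
move=> xC; apply: (@le_trans _ _ (\sum_(i < n) C)); first exact: ler_sum.
by rewrite sumr_const card_ord mulr_natl.
Qed.

Lemma coord_le_l1norm x i : `|x ord0 i| <= l1norm x.
Proof. by rewrite /l1norm (bigD1 i)//= lerDl sumr_ge0. Qed.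

Lemma norm_le_enorm x : `|x| <= enorm x.
Proof.
rewrite [leLHS]/Num.norm/= mx_normrE; apply/bigmax_leP; split=> [|[i j] _ /=].
  exact: enorm_ge0.
by rewrite ord1 coord_le_enorm.
Qed.

Lemma coord_le_norm x i : `|x ord0 i| <= `|x|.
Proof.
by rewrite [leRHS]/Num.norm/= mx_normrE (le_bigmax _ (fun p => `|x p.1 p.2|) (ord0, i)).
Qed.

Lemma l1norm_le_norm x : l1norm x <= n%:R * `|x|.
Proof. by apply: l1norm_le_const => i; exact: coord_le_norm. Qed.

End norms.

(** * Trajectories *)

Section integral_bound.
Context {R : realType}.

Lemma Rintegral_itvoc_le (g : R -> R) (s t B : R) : s <= t ->
  leb.-integrable `]s, t] (fun r : lebesgueR R => (g r)%:E) ->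
  (forall r, s < r <= t -> `|g r| <= B) ->
  `|\int[leb]_(r in `]s, t]) g r| <= B * (t - s).
Proof.
move=> st ig gB; have mI := measurable_leb_itv `]s, t].
apply: (le_trans (le_normr_Rintegral mI ig)).
have muI : leb (`]s, t]%classic : set (lebesgueR R)) = (t - s)%:E.
  exact: leb_itv.
apply: (@le_trans _ _ (\int[leb]_(r in `]s, t]) B)).
  apply: le_Rintegral => //.
  - exact: integrable_norm.
  - apply/integrableP; split; first exact: measurable_cst.
    by rewrite /= integral_cst// [X in (_ * X)%E]muI ltry.
by rewrite Rintegral_cst// [X in fine X]muI.
Qed.

End integral_bound.

Section flow.
Context {R : realType} {n m : nat}.
Variable f : 'rV[R]_n -> 'rV[R]_m -> 'rV[R]_n.
Implicit Types (z w : R -> 'rV[R]_n) (a b : R -> 'rV[R]_m).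

(* The integral equation in incremental form; unlike [is_solution] it is stable
   under time shifts and ignores the control at time 0. *)
Definition flow z a : Prop := forall s t, 0 <= s -> s <= t -> forall i,
  leb.-integrable `]s, t] (fun r : lebesgueR R => (f (z r) (a r) ord0 i)%:E) /\
  z t ord0 i = z s ord0 i + \int[leb]_(r in `]s, t]) f (z r) (a r) ord0 i.

Lemma is_solution_init x a z : is_solution f x a z -> z 0 = x.
Proof.
move=> /(_ 0 (lexx _))[intf ->]; apply/rowP => i; rewrite !mxE.
have mI := measurable_leb_itv (`[0, 0] : interval R).
have I0 : leb (`[0, 0]%classic : set (lebesgueR R)) = 0%E.
  by rewrite (leb_itv true false (lexx 0)) subrr.
have mg := measurable_int leb (intf i).
by rewrite /Rintegral (null_set_integral mI mg I0) addr0.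
Qed.

Lemma is_solution_flow x a z : is_solution f x a z -> flow z a.
Proof.
move=> za s t s0 st i; have t0 := le_trans s0 st.
have [/(_ i) zt Et] := za t t0; have [/(_ i) zs Es] := za s s0.
have ms := measurable_leb_itv `[0, s]; have mst := measurable_leb_itv `]s, t].
have tU : (`[0, t] = `[0, s] `|` `]s, t])%classic.
  by rewrite (@itv_bndbnd_setU _ _ _ (BRight s))// bnd_simp.
split.
  apply: integrableS zt => //; first exact: measurable_leb_itv.
  by rewrite tU; exact: subsetUr.
rewrite Et Es !mxE -addrA; congr (_ + _).
rewrite tU Rintegral_setU//; first by rewrite -tU.
rewrite disj_set2E; apply/eqP; rewrite -subset0 => r [] /=; rewrite !in_itv/=.
by move=> /andP[_ rs] /andP[+ _]; rewrite ltNge rs.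
Qed.

(** Meant for the junction of two controls, where a shifted concatenation may differ from the second
    control at time 0. The intervals []s, t]] with [0 <= s] do not contain that time. *)
Lemma flow_eq_control z a b : (forall r, 0 < r -> a r = b r) ->
  flow z a -> flow z b.
Proof.
move=> ab za s t s0 st i; have [iz Ez] := za s t s0 st i.
have E r : r \in (`]s, t]%classic : set R) ->
    f (z r) (b r) ord0 i = f (z r) (a r) ord0 i.
  by rewrite inE/= in_itv/= => /andP[sr _]; rewrite ab// (le_lt_trans s0).
split; first by apply: eq_integrable iz => [|r rI]; [exact: measurable_leb_itv|rewrite E].
by rewrite Ez; congr (_ + _); apply: eq_Rintegral => r rI; rewrite E.
Qed.

(** The dynamics depend on time only through the control, so translation invariance of [leb]
    suffices. *)
Lemma flow_shift c z a : 0 <= c -> flow z a -> flow (z \o shift c) (a \o shift c).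
Proof.
move=> c0 za s t s0 st i.
have [||iz Ez] := za (s + c) (t + c) _ _ i; [exact: addr_ge0|by rewrite lerD2r|].
have pre : shift c @^-1` `]s + c, t + c] = `]s, t]%classic.
  by rewrite preimage_shift_itvoc !addrK.
have mI := measurable_leb_itv `]s + c, t + c].
have mg := measurable_int leb iz.
split.
  apply/integrableP; split.
    by rewrite -pre; exact: (measurable_fun_shift mI mg).
  have mag := measurableT_comp (@abse_measurable R setT) mg.
  have [_] := integrableP _ _ _ iz.
  by rewrite (integral_shift c mI mag) pre.
rewrite /comp/= Ez; congr (_ + _).
by rewrite /Rintegral (@integral_shift _ c)// pre.
Qed.

Lemma flow_diff_le z w a b (s t B : R) i : flow z a -> flow w b ->
  0 <= s -> s <= t ->
  (forall r, s < r <= t -> `|f (z r) (a r) ord0 i - f (w r) (b r) ord0 i| <= B) ->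
  `|z t ord0 i - w t ord0 i| <= `|z s ord0 i - w s ord0 i| + B * (t - s).
Proof.
move=> za wb s0 st fB.
have [iz ->] := za s t s0 st i; have [iw ->] := wb s t s0 st i.
rewrite opprD addrACA -RintegralB//; last exact: measurable_leb_itv.
apply: (le_trans (ler_normD _ _)); rewrite lerD2l Rintegral_itvoc_le//.
have := @integrableB _ _ _ leb _ (measurable_leb_itv `]s, t]) _ _ iz iw.
by [].
Qed.

Lemma flow_incr_le z a (s t B : R) i : flow z a -> 0 <= s -> s <= t ->
  (forall r, s < r <= t -> `|f (z r) (a r) ord0 i| <= B) ->
  `|z t ord0 i - z s ord0 i| <= B * (t - s).
Proof.
move=> za s0 st fB; have [iz ->] := za s t s0 st i.
by rewrite addrC addKr Rintegral_itvoc_le.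
Qed.

(* From integrability alone, without the growth condition. *)
Lemma flow_bounded z a (tau : R) : flow z a -> 0 <= tau ->
  exists C, forall t, 0 <= t <= tau -> l1norm (z t) <= C.
Proof.
move=> za tau0.
exists (\sum_i (`|z 0 ord0 i| + \int[leb]_(r in `]0, tau]) `|f (z r) (a r) ord0 i|)).
move=> t /andP[t0 tt]; apply: ler_sum => i _.
have [iz ->] := za 0 t (lexx _) t0 i.
have [itau _] := za 0 tau (lexx _) tau0 i.
apply: (le_trans (ler_normD _ _)); rewrite lerD2l.
have m1 := measurable_leb_itv `]0, t].
have m2 := measurable_leb_itv `]t, tau].
apply: (le_trans (le_normr_Rintegral m1 iz)).
have tU : (`]0, tau] = `]0, t] `|` `]t, tau])%classic.
  by rewrite (@itv_bndbnd_setU _ _ _ (BRight t))// bnd_simp.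
rewrite tU Rintegral_setU//.
- by rewrite lerDl Rintegral_ge0.
- rewrite -tU; exact: integrable_norm.
- rewrite disj_set2E; apply/eqP; rewrite -subset0 => r [] /=; rewrite !in_itv/=.
  by move=> /andP[_ rs] /andP[+ _]; rewrite ltNge rs.
Qed.

Section with_assumptions.
Variables (A : set 'rV[R]_m) (M : R).
Hypothesis M0 : 0 < M.
Hypothesis hgrowth : forall x v, A v -> enorm (f x v) <= M * (1 + enorm x).
Hypothesis hlip : forall Rad : R, 0 < Rad -> exists2 L : R, 0 < L &
     forall x1 x2 v, enorm x1 <= Rad -> enorm x2 <= Rad -> A v ->
       enorm (f x1 v - f x2 v) <= L * enorm (x1 - x2).

(** Adding 1 turns the affine growth bound into a linear one, of rate [n * M] after summation over
    the coordinates. [flow_bounded] supplies the a priori bound that Grönwall requires. *)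
Lemma flow_growth z a k (t : R) : flow z a -> (forall r, 0 <= r -> A (a r)) ->
  0 <= t -> n%:R * M * t <= k%:R / 2 ->
  1 + l1norm (z t) <= 2 ^+ k * (1 + l1norm (z 0)).
Proof.
move=> za Aa t0 kt; have [C zC] := flow_bounded za t0.
pose u r := 1 + l1norm (z r).
have u0 r : 0 <= u r by rewrite addr_ge0// l1norm_ge0.
apply: (@gronwall_doubling _ u (n%:R * M) t (1 + C)) => //.
- by rewrite mulr_ge0// ltW.
- by move=> r rt; rewrite lerD2l zC.
- move=> s r B s0 sr rt uB; rewrite /u -addrA lerD2l.
  have -> : n%:R * M * (r - s) * B = \sum_(i < n) (M * B * (r - s)).
    by rewrite sumr_const card_ord -mulr_natl; ring.
  rewrite /l1norm -big_split/=; apply: ler_sum => i _.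
  rewrite -lerBlDl (le_trans (lerB_dist _ _))// (flow_incr_le za)// => q /andP[sq qr].
  apply: (le_trans (coord_le_enorm _ _)).
  apply: (le_trans (hgrowth _ (Aa _ _))); first exact: le_trans (ltW sq).
  rewrite ler_pM2l// (le_trans _ (uB q _)) ?sq//.
  by rewrite lerD2l enorm_le_l1norm.
- by rewrite t0 lexx.
Qed.

(** Grönwall for the difference of two trajectories. The ball of radius [Rad] fixes one Lipschitz
    constant and also bounds the difference a priori. *)
Lemma flow_stable z w a b (Rad L : R) k (t : R) :
  (forall x1 x2 v, enorm x1 <= Rad -> enorm x2 <= Rad -> A v ->
     enorm (f x1 v - f x2 v) <= L * enorm (x1 - x2)) -> 0 <= L ->
  flow z a -> flow w b -> (forall r, 0 <= r -> A (a r)) ->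
  (forall r, 0 < r <= t -> a r = b r) ->
  (forall r, 0 <= r <= t -> enorm (z r) <= Rad /\ enorm (w r) <= Rad) ->
  0 <= t -> n%:R * L * t <= k%:R / 2 ->
  l1norm (z t - w t) <= 2 ^+ k * l1norm (z 0 - w 0).
Proof.
move=> lip L0 za wb Aa ab zwR t0 kt; pose u r := l1norm (z r - w r).
apply: (@gronwall_doubling _ u (n%:R * L) t (n%:R * (Rad + Rad))) => //.
- by rewrite mulr_ge0.
- by move=> r; exact: l1norm_ge0.
- move=> r /zwR[zR wR]; apply: l1norm_le_const => i; rewrite !mxE.
  by rewrite (le_trans (ler_normB _ _))// lerD// (le_trans (coord_le_enorm _ _)).
- move=> s r B s0 sr rt uB; rewrite /u.
  have -> : n%:R * L * (r - s) * B = \sum_(i < n) (L * B * (r - s)).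
    by rewrite sumr_const card_ord -mulr_natl; ring.
  rewrite /l1norm -big_split/=; apply: ler_sum => i _; rewrite !mxE.
  apply: (flow_diff_le za wb) => // q /andP[sq qr].
  have q0 : 0 < q by exact: le_lt_trans sq.
  have [|zq wq] := zwR q; first by rewrite (ltW q0) (le_trans qr).
  rewrite -ab ?q0 ?(le_trans qr)//.
  have := coord_le_enorm (f (z q) (a q) - f (w q) (a q)) i; rewrite !mxE.
  move/le_trans; apply; apply: (le_trans (lip _ _ _ zq wq (Aa _ (ltW q0)))).
  by rewrite ler_wpM2l// (le_trans (enorm_le_l1norm _))// uB// sq.
- by rewrite t0 lexx.
Qed.

(** Provides the number of doublings that Grönwall needs on a given time interval. *)
Lemma archi_half (x : R) : exists k : nat, x <= k%:R / 2.
Proof.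
exists (Num.truncn (x * 2)).+1.
by rewrite ler_pdivlMr// ltW// truncnS_gt.
Qed.

Lemma flow_enorm_bounded z a (tau : R) : flow z a -> (forall r, 0 <= r -> A (a r)) ->
  exists2 C, 0 < C & forall t, 0 <= t <= tau -> enorm (z t) <= C.
Proof.
move=> za Aa; have [k kt] := archi_half (n%:R * M * tau).
exists (2 ^+ k * (1 + l1norm (z 0))).
  by rewrite mulr_gt0 ?exprn_gt0// ltr_pwDl ?l1norm_ge0.
move=> t /andP[t0 tt]; apply: le_trans (flow_growth za Aa t0 _).
  by rewrite (le_trans (enorm_le_l1norm _))// lerDr.
by rewrite (le_trans _ kt)// ler_wpM2l// mulr_ge0// ltW.
Qed.

(** Stability with zero initial difference, inside a ball of radius [C + D] that contains both
    trajectories. *)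
Lemma flow_unique z w a b (tau : R) : flow z a -> flow w b ->
  (forall r, 0 <= r -> A (a r)) -> (forall r, 0 <= r -> A (b r)) ->
  (forall r, 0 < r <= tau -> a r = b r) -> z 0 = w 0 ->
  forall t, 0 <= t <= tau -> z t = w t.
Proof.
move=> za wb Aa Ab ab zw0 t /andP[t0 tt].
have [C C0 zC] := flow_enorm_bounded tau za Aa.
have [D D0 wD] := flow_enorm_bounded tau wb Ab.
have [L L0 lip] := hlip (addr_gt0 C0 D0).
have [k kt] := archi_half (n%:R * L * t).
have : l1norm (z t - w t) <= 2 ^+ k * l1norm (z 0 - w 0).
  apply: (flow_stable lip (ltW L0) za wb) => //.
  - by move=> r /andP[r0 rt]; apply: ab; rewrite r0 (le_trans rt).
  - move=> r /andP[r0 rt]; split.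
      by rewrite (le_trans (zC _ _)) ?r0 ?(le_trans rt)// lerDl ltW.
    by rewrite (le_trans (wD _ _)) ?r0 ?(le_trans rt)// lerDr ltW.
rewrite zw0 subrr [l1norm 0]big1 ?mulr0 => [zw|i _]; last by rewrite mxE normr0.
apply/rowP => i; apply/eqP; rewrite -subr_eq0 -normr_le0.
by have := le_trans (coord_le_l1norm (z t - w t) i) zw; rewrite !mxE.
Qed.

(** On a bounded time interval the trajectory stays in a ball of radius [C], so its speed is at most
    [M * (1 + C)]. *)
Lemma flow_lipschitz z a (tau : R) : flow z a -> (forall r, 0 <= r -> A (a r)) ->
  exists2 C, 0 < C & forall s t, 0 <= s <= tau -> 0 <= t <= tau ->
    enorm (z t - z s) <= C * `|t - s|.
Proof.
move=> za Aa; have [C C0 zC] := flow_enorm_bounded tau za Aa.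
(* Taking [n.+1] instead of [n] keeps the constant positive when [n = 0]. *)
exists (n.+1%:R * (M * (1 + C))); first by rewrite !mulr_gt0// addr_gt0.
move=> s t.
wlog st : s t / s <= t.
  move=> H; have [st|/ltW ts] := leP s t; first exact: H.
  move=> s0 t0; rewrite distrC -[leLHS]/(enorm (z t - z s)).
  have -> : enorm (z t - z s) = enorm (z s - z t).
    by rewrite /enorm; congr Num.sqrt; apply: eq_bigr => i _; rewrite !mxE -sqrrN opprB.
  exact: H.
move=> /andP[s0 stau] /andP[t0 ttau].
apply: (le_trans (enorm_le_l1norm _)).
apply: (@le_trans _ _ (n%:R * (M * (1 + C) * `|t - s|))); last first.
  rewrite mulrA ler_wpM2r// ler_wpM2r ?ler_nat// mulr_ge0// ?ltW// addr_gt0//.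
apply: l1norm_le_const => i; rewrite !mxE (ger0_norm (_ : 0 <= t - s)) ?subr_ge0//.
apply: (flow_incr_le za) => // r /andP[sr rt].
have r0 : 0 <= r by rewrite (le_trans s0)// ltW.
apply: (le_trans (coord_le_enorm _ _)); apply: (le_trans (hgrowth _ (Aa _ r0))).
by rewrite ler_pM2l// lerD2l zC// r0 (le_trans rt).
Qed.

End with_assumptions.
End flow.

(** * Concatenated controls and running costs *)

Section concatenation.
Context {R : realType} {m : nat}.
Variable A : set 'rV[R]_m.

(** The junction time belongs to the first control, so the value [b 0] is never taken. *)
Definition concat (c : R) (a b : R -> 'rV[R]_m) : R -> 'rV[R]_m :=
  fun t => if t <= c then a t else b (t - c).

Lemma control_concat c a b : 0 <= c -> control A a -> control A b ->
  control A (concat c a b).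
Proof.
move=> c0 [Aa ma] [Ab mb]; split=> [t t0|].
  rewrite /concat; case: ifPn => [_|]; first exact: Aa.
  by rewrite -ltNge => /ltW ct; apply: Ab; rewrite subr_ge0.
have m1 := measurable_leb_itv (`[0, c] : interval R).
have m2 := measurable_leb_itv (`]c, +oo[ : interval R).
have m3 := measurable_leb_itv (`]0, +oo[ : interval R).
have m4 := measurable_leb_itv (`[0, +oo[ : interval R).
have -> : (`[0, +oo[ = `[0, c] `|` `]c, +oo[ :> set R)%classic.
  by rewrite (@itv_bndbnd_setU _ _ _ (BRight c))// bnd_simp.
apply/(measurable_funU _ m1 m2); split.
  have : @measurable_fun _ _ (lebesgueR R) (borel_rV R m) `[0, c] a.
    by apply: (measurable_funS m4) ma; apply: subset_itvl; rewrite bnd_simp.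
  apply: eq_measurable_fun => t; rewrite inE /= in_itv/= => /andP[_ tc].
  by rewrite /concat tc.
have mb' : @measurable_fun _ _ (lebesgueR R) (borel_rV R m) `]0, +oo[ b.
  by apply: (measurable_funS m4) mb; apply: subset_itvr; rewrite bnd_simp.
have pre : shift (- c) @^-1` `]0, +oo[ = `]c, +oo[%classic.
  by apply/seteqP; split=> x; rewrite /shift/= !in_itv/= !andbT subr_gt0.
have := @measurable_fun_shift R (- c) _ (borel_rV R m) _ b m3 mb'.
rewrite pre; apply: eq_measurable_fun => t; rewrite inE /= in_itv/= andbT => ct.
by rewrite /concat leNgt ct.
Qed.

End concatenation.

(** * Measurability of the running cost along a trajectory *)

Section running_cost.
Context {R : realType} {n m : nat}.
Variables (A : set 'rV[R]_m) (l : 'rV[R]_n -> 'rV[R]_m -> R).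
Hypothesis hl : {within [set p : 'rV[R]_n * 'rV[R]_m | A p.2],
           continuous (fun p => l p.1 p.2)}.

(** [l q] is continuous only relative to [A]. The preimage of an open interval is the trace on [A]
    of an open slice, and the control takes its values in [A], so pulling back by the control sees
    only that slice, a Borel set. *)
Lemma measurable_running_cost_const q a : control A a ->
  @measurable_fun _ _ (lebesgueR R) _ `[0, +oo[ (fun s : lebesgueR R => l q (a s)).
Proof.
move=> [Aa ma] mD; apply: (measurability _ (RGenOpens.measurableE R)) => //.
move=> _ [_ [x [y ->]] <-].
have /open_subspaceP[V oV VE] :
    open ((fun p : subspace [set p : 'rV[R]_n * 'rV[R]_m | A p.2] => l p.1 p.2)
            @^-1` `]x, y[).
  by move/continuousP : hl; apply; exact: interval_open.
have oW : open [set b : 'rV[R]_m | V (q, b)].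
  have cq : continuous (fun b : 'rV[R]_m => (q, b)).
    by move=> b; apply: (@cvg_pair _ _ _ (nbhs b) (nbhs q) (nbhs b));
      [exact: cvg_cst|exact: cvg_id].
  by move/continuousP : cq; apply.
have mV : @measurable _ (borel_rV R m) [set b | V (q, b)].
  by apply: sub_sigma_algebra.
have := ma mD _ mV.
congr (measurable _); apply/seteqP; split=> [t [/= t0 Vt]|t [/= t0 xy]].
  split=> //.
  have : (V `&` [set p : 'rV[R]_n * 'rV[R]_m | A p.2]) (q, a t).
    by split => //=; apply: Aa; move: t0; rewrite in_itv/= andbT.
  by rewrite VE => -[].
split=> //.
have : ((fun p : 'rV[R]_n * 'rV[R]_m => l p.1 p.2) @^-1` `]x, y[ `&`
        [set p : 'rV[R]_n * 'rV[R]_m | A p.2]) (q, a t).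
  by split => //=; apply: Aa; move: t0; rewrite in_itv/= andbT.
by rewrite -VE => -[].
Qed.

(* The state is frozen on a grid of mesh [1 / k.+1]: on each cell only the
   control varies, and the Lipschitz bounds give the pointwise limit. *)
Lemma measurable_running_cost z a : control A a ->
  (forall Rad : R, 0 < Rad -> exists2 L : R, 0 < L &
     forall x1 x2 a, enorm x1 <= Rad -> enorm x2 <= Rad -> A a ->
       `|l x1 a - l x2 a| <= L * enorm (x1 - x2)) ->
  (forall tau : R, exists2 C : R, 0 < C & forall t, 0 <= t <= tau -> enorm (z t) <= C) ->
  (forall tau : R, exists2 C : R, 0 < C & forall s t, 0 <= s <= tau -> 0 <= t <= tau ->
    enorm (z t - z s) <= C * `|t - s|) ->
  @measurable_fun _ _ (lebesgueR R) _ `[0, +oo[ (fun s : lebesgueR R => l (z s) (a s)).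
Proof.
move=> ca lip zb zlip.
pose grid k (s : R) : R := (Num.truncn (s * k.+1%:R))%:R / k.+1%:R.
have gridP k s : 0 <= s -> [/\ 0 <= grid k s, grid k s <= s & s - grid k s <= k.+1%:R^-1].
  move=> s0; have sk0 : 0 <= s * k.+1%:R by rewrite mulr_ge0.
  have /andP[h1 h2] := truncn_itv sk0.
  split; first by rewrite divr_ge0.
  - by rewrite ler_pdivrMr.
  - by rewrite lerBlDr -(ler_pM2r (ltr0Sn R k)) mulrDl mulVf// divfK// addrC natr1 ltW.
apply: (@measurable_fun_cvg _ (lebesgueR R) R _ (fun k s => l (z (grid k s)) (a s))).
- move=> k.
  pose E j : set R := `[j%:R / k.+1%:R, j.+1%:R / k.+1%:R[%classic.
  have mE j : measurable (E j : set (lebesgueR R)) by exact: measurable_leb_itv.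
  have E0 j s : E j s -> 0 <= s.
    by rewrite /E/= in_itv/= => /andP[+ _]; apply: le_trans; rewrite divr_ge0.
  have -> : (`[0, +oo[%classic : set R) = \bigcup_j E j.
    apply/seteqP; split=> [s|s [j _ /E0]]; rewrite /= in_itv/= andbT// => s0.
    exists (Num.truncn (s * k.+1%:R)) => //; rewrite /E/= in_itv/=.
    have /andP[h1 h2] := truncn_itv (mulr_ge0 s0 (ler0n R k.+1)).
    by rewrite ler_pdivrMr// ltr_pdivlMr// h1 h2.
  apply/(measurable_fun_bigcup _ mE) => j.
  have : @measurable_fun _ _ (lebesgueR R) _ (E j)
      (fun s : lebesgueR R => l (z (j%:R / k.+1%:R)) (a s)).
    have m0 := measurable_leb_itv (`[0, +oo[ : interval R).
    apply: (measurable_funS m0 _ (measurable_running_cost_const _ ca)).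
    by move=> s /E0; rewrite /= in_itv/= andbT.
  apply: eq_measurable_fun => s; rewrite inE => Es.
  have := Es; rewrite /E/= in_itv/= ler_pdivrMr// ltr_pdivlMr// => js.
  by rewrite /grid (truncn_def js).
- move=> s; rewrite /= in_itv/= andbT => s0.
  have [C C0 zC] := zlip s; have [B B0 zB] := zb s; have [L L0 lipL] := lip B B0.
  apply/cvgrPdist_le => e e0; near=> k.
  have [g0 gs gd] := gridP k s s0.
  apply: (le_trans (lipL _ _ _ (zB _ _) (zB _ _) (ca.1 _ s0))).
  + by rewrite s0 lexx.
  + by rewrite g0 gs.
  apply: (le_trans (ler_wpM2l (ltW L0) (zC _ _ _ _))).
  + by rewrite g0 gs.
  + by rewrite s0 lexx.
  rewrite ger0_norm ?subr_ge0// mulrA.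
  apply: (le_trans (ler_wpM2l (mulr_ge0 (ltW L0) (ltW C0)) gd)).
  rewrite ler_pdivrMr// -ler_pdivrMl// mulrC.
  (* The error is at most [L * C / k.+1], hence at most [e] once [k] exceeds [L * C / e]. *)
  near: k; exists (Num.truncn (L * C / e)).+1 => // k /= ke.
  rewrite (le_trans (ltW (truncnS_gt _)))// ler_nat.
  by rewrite (leq_trans ke).
Unshelve. all: by end_near. Qed.

End running_cost.

(** * Distance to the target and hitting times *)

Lemma left_filter_proper {R : realType} (t : \bar R) : ProperFilter (left_filter t).
Proof.
case: t => [r| |] /=.
- exact: at_left_proper_filter.
- exact: proper_pinfty_nbhs.
- exact: proper_ninfty_nbhs.
Qed.

(** For nonnegative [g] the lower limit is positive only if some set of the filter keeps [g] away
    from 0. In this form admissibility can be checked along explicit times. *)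
Lemma limf_einf_eq0P {R : realType} (g : R -> \bar R) (F : set_system R) :
  ProperFilter F -> (forall t, 0 <= g t)%E ->
  limf_einf g F = 0%E <->
  (forall (e : R) V, 0 < e -> F V -> exists2 t, V t & (g t < e%:E)%E).
Proof.
move=> FF g0; rewrite limf_einfE; split=> [lim0 e V e0 FV|H].
  have : (ereal_inf (g @` V) < e%:E)%E.
    apply: (@le_lt_trans _ _ 0%E); last by rewrite lte_fin.
    by rewrite -lim0; apply: ereal_sup_ubound; exists V.
  by move=> /ereal_inf_lt[_ [t Vt <-] gt]; exists t.
apply/eqP; rewrite eq_le; apply/andP; split.
  apply: ge_ereal_sup => _ [V FV <-]; apply/lee_addgt0Pr => e e0; rewrite add0e.
  have [t Vt gt] := H e V e0 FV.
  by rewrite (le_trans _ (ltW gt))//; apply: ereal_inf_lbound; exists t.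
apply: (@le_trans _ _ (ereal_inf (g @` setT))).
  by apply: le_ereal_inf_tmp => _ [t _ <-].
by apply: ereal_sup_ubound; exists setT => //; exact: filterT.
Qed.

Section target.
Context {R : realType} {n : nat}.
Implicit Types (T : set 'rV[R]_n) (z : R -> 'rV[R]_n) (x w : 'rV[R]_n).

Lemma dist_ge0 T x : (0 <= dist T x)%E.
Proof. by apply: le_ereal_inf_tmp => _ [w _ <-]; rewrite lee_fin enorm_ge0. Qed.

Lemma dist_le T x w : T w -> (dist T x <= (enorm (x - w))%:E)%E.
Proof. by move=> Tw; apply: ereal_inf_lbound; exists w. Qed.

Lemma dist_lt T x (d : R) : (dist T x < d%:E)%E ->
  exists2 w, T w & enorm (x - w) < d.
Proof. by move=> /ereal_inf_lt[_ [w Tw <-]]; rewrite lte_fin => ?; exists w. Qed.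

(** [nbhd] is a closure, so a point of it is first approximated within [delta]; this costs the
    factor 2. *)
Lemma nbhd_near T (delta : R) x : 0 < delta -> nbhd T delta x ->
  exists2 w, T w & `|x - w| < delta *+ 2.
Proof.
move=> d0 /(_ (ball x delta) (nbhsx_ballx _ _ d0))[x' [/dist_lt[w Tw x'w]]].
rewrite -ball_normE/= => xx'; exists w => //.
rewrite -(subrKA x') mulr2n (le_lt_trans (ler_normD _ _))// ltrD//.
exact: le_lt_trans (norm_le_enorm _) x'w.
Qed.

Lemma sub_nbhd T (delta : R) : 0 < delta -> T `<=` nbhd T delta.
Proof.
move=> d0 x Tx; apply: subset_closure; apply: le_lt_trans (dist_le x Tx) _.
rewrite subrr lte_fin (le_lt_trans (enorm_le_l1norm _))//.
by rewrite /l1norm big1// => i _; rewrite mxE normr0.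
Qed.

Lemma closed_nbhd T (delta : R) : closed (nbhd T delta).
Proof. exact: closed_closure. Qed.

Lemma closed_avoid T x : closed T -> ~ T x ->
  exists2 e : R, 0 < e & forall w, `|x - w| < e -> ~ T w.
Proof.
move=> cT Tx; have : nbhs x (~` T) by apply: open_nbhs_nbhs; split => //; exact: closed_openC.
by move=> /nbhs_ballP[e /= e0 xe]; exists e => // w xw; apply: xe; rewrite -ball_normE.
Qed.

Lemma outside_boundary T x : closed T -> T x -> outside T x -> boundary T x.
Proof. by move=> cT Tx oTx; split => //; exact: subset_closure. Qed.

Lemma notin_outside T x : ~ T x -> outside T x.
Proof. by move=> Tx /interior_subset. Qed.

(** On the segment from [w] to [x], the last point belonging to [T] is a boundary point. *)
Lemma boundary_between T x w : closed T -> T w -> ~ T x ->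
  exists2 b, boundary T b & `|x - b| <= `|x - w|.
Proof.
move=> cT Tw Tx; pose g t := w + t *: (x - w).
have xw0 : 0 < `|x - w|.
  by rewrite normr_gt0 subr_eq0; apply/eqP => xw; apply: Tx; rewrite xw.
have gd s t : `|g s - g t| = `|s - t| * `|x - w|.
  by rewrite /g opprD addrACA subrr add0r -scalerBl normrZ.
pose E := [set t | 0 <= t <= 1 /\ T (g t)].
have E0 : E 0 by split; [rewrite lexx ler01|rewrite /g scale0r addr0].
have supE : has_sup E.
  by split; [exists 0|exists 1 => t [/andP[]]].
have s0 : 0 <= sup E by apply: ub_le_sup => //; case: supE.
have s1 : sup E <= 1 by apply: ge_sup; [exists 0|move=> t [/andP[]]].
have Ts : T (g (sup E)).
  apply: contrapT => /(closed_avoid cT)[e e0 He].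
  have [t [t01 Tt] st] := sup_adherent (divr_gt0 e0 xw0) supE.
  have ts : t <= sup E by apply: ub_le_sup => //; case: supE.
  apply: (He (g t)) => //; rewrite gd -ltr_pdivlMr// ger0_norm ?subr_ge0//.
  by move: st; lra.
exists (g (sup E)); last first.
  have {1}-> : x = g 1 by rewrite /g scale1r addrC subrK.
  by rewrite gd ger0_norm ?subr_ge0// ler_piMl// lerBlDr lerDl.
split; first exact: subset_closure.
(* Were this point interior, the segment would stay in [T] a little beyond the supremum, which is
   less than 1 because [x] is not in [T]. *)
move=> /nbhs_ballP[e /= e0 Te].
have slt1 : sup E < 1.
  rewrite lt_neqAle s1 andbT; apply/eqP => sE.
  by apply: Tx; move: Ts; rewrite sE /g scale1r addrC subrK.
pose t := Num.min 1 (sup E + e / 2 / `|x - w|).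
have d0 : 0 < e / 2 / `|x - w| by rewrite !divr_gt0.
have st : sup E < t by rewrite lt_min slt1/= ltrDl.
have t1 : t <= 1 by rewrite ge_min lexx.
suff : E t by move=> Et; have := ub_le_sup supE.2 Et; rewrite leNgt st.
split; first by rewrite t1 (le_trans s0)// ltW.
apply: Te; rewrite -ball_normE/= gd distrC ger0_norm ?subr_ge0 ?ltW//.
have : t <= sup E + e / 2 / `|x - w| by rewrite ge_min lexx orbT.
rewrite -lerBlDl ler_pdivlMr// => /le_lt_trans; apply.
by rewrite ltr_pdivrMr// ltr_pMr// ltrDl.
Qed.

(** Each boundary point has a ball on which [V] is small, and compactness makes the radius uniform.
    A point off [T] that is close to [T] is equally close to the boundary by [boundary_between]. *)
Lemma small_near_boundary T (V : 'rV[R]_n -> \bar R) (eps : R) :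
  closed T -> compact (boundary T) -> (forall x, T x -> V x = 0%E) ->
  (forall b, boundary T b -> V @ within (outside T) (nbhs b) --> V b) ->
  0 < eps ->
  exists2 delta : R, 0 < delta & forall x w, outside T x -> T w ->
    `|x - w| < delta -> (V x <= eps%:E)%E.
Proof.
move=> cT /compact_near_coveringP cb V0 cV eps0.
have := cb R 0^'+ (fun d b => forall x, outside T x -> `|x - b| < d -> (V x <= eps%:E)%E) _.
case=> [b bb|d /= d0 Hd].
  have Tb : T b by rewrite (closure_id T).1//; case: bb.
  have Nb : nbhs (V b) [set v | (v < eps%:E)%E].
    rewrite V0//; apply: open_nbhs_nbhs.
    by split; [exact: open_ereal_lt_ereal|rewrite /= lte_fin].
  have : nbhs b [set x | outside T x -> (V x < eps%:E)%E] := cV b bb _ Nb.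
  move=> /nbhs_ballP[r /= r0 Hr].
  exists (ball b (r / 2), [set d | d < r / 2]) => /=.
    split; first by apply: nbhsx_ballx; rewrite divr_gt0.
    by apply: nbhs_right_lt; rewrite divr_gt0.
  move=> [b' d] /= [bb' dr] x ox xb'; apply/ltW/Hr => //.
  move: bb'; rewrite -!ball_normE/= => bb'.
  rewrite -(subrKA b') (splitr r) (le_lt_trans (ler_normD _ _))// ltrD//.
  by rewrite distrC (lt_trans xb').
(* The covering property holds for parameters strictly between 0 and [d]. *)
exists (d / 2); first by rewrite divr_gt0.
move=> x w ox Tw xw; have [Tx|Tx] := pselect (T x); first by rewrite V0// lee_fin ltW.
have [b bb xb] := boundary_between cT Tw Tx.
apply: (Hd (d / 2)) bb _ ox _ => /=.
- by rewrite sub0r normrN gtr0_norm ?divr_gt0// ltr_pdivrMr// ltr_pMr// ltrDl.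
- by rewrite divr_gt0.
- exact: le_lt_trans xb xw.
Qed.

(** The only regularity of trajectories on which the hitting-time lemmas rely. *)
Definition loc_lipschitz z := forall tau : R, exists2 C : R, 0 < C &
  forall s t, 0 <= s <= tau -> 0 <= t <= tau -> enorm (z t - z s) <= C * `|t - s|.

Lemma hit_time_ge0 T z : (0 <= hit_time T z)%E.
Proof. by apply: le_ereal_inf_tmp => _ [t [t0 _] <-]; rewrite lee_fin. Qed.

Lemma hit_time_le T z t : 0 <= t -> T (z t) -> (hit_time T z <= t%:E)%E.
Proof. by move=> t0 Tt; apply: ereal_inf_lbound; exists t. Qed.

(** If [z h] were off the closed set [T], the Lipschitz bound would keep [z] off [T] for a while
    after [h], against the definition of the infimum. *)
Lemma hit_time_attained T z (h : R) : closed T -> loc_lipschitz z ->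
  hit_time T z = h%:E -> 0 <= h /\ T (z h).
Proof.
move=> cT zlip hE; have h0 : 0 <= h by rewrite -lee_fin -hE hit_time_ge0.
split=> //; apply: contrapT => /(closed_avoid cT)[e e0 He].
have [C C0 zC] := zlip (h + 1).
(* The minimum with 1 keeps the times below [h + 1], where [C] is valid. *)
pose d := Num.min 1 (e / C).
have d0 : 0 < d by rewrite lt_min ltr01 divr_gt0.
have : (hit_time T z < (h + d)%:E)%E by rewrite hE lte_fin ltrDl.
move=> /ereal_inf_lt[_ [t [t0 Tt] <-]]; rewrite lte_fin => thd.
have ht : h <= t by rewrite -lee_fin -hE hit_time_le.
have td : t - h < d by rewrite ltrBlDl.
apply: (He (z t)) => //; rewrite distrC (le_lt_trans (norm_le_enorm _))//.
apply: (le_lt_trans (zC _ _ _ _)).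
- by rewrite h0 lerDl ler01.
- by rewrite t0 (le_trans (ltW thd))// lerD2l ge_min lexx.
- rewrite ger0_norm ?subr_ge0// -ltr_pdivlMl// mulrC (lt_le_trans td)//.
  by rewrite ge_min lexx orbT.
Qed.

Lemma hit_time_gt0 T z : closed T -> loc_lipschitz z -> ~ T (z 0) ->
  (0 < hit_time T z)%E.
Proof.
move=> cT zlip Tz0; rewrite lt_neqAle hit_time_ge0 andbT; apply/eqP => h0.
by have [] := hit_time_attained cT zlip (esym h0).
Qed.

(** The two infima differ only by the time 0, which the hypothesis rules out. The hitting-time
    lemmas thus apply to the enlarged target. *)
Lemma nbhd_time_hit_time T (delta : R) z : ~ nbhd T delta (z 0) ->
  nbhd_time T delta z = hit_time (nbhd T delta) z.
Proof.
move=> Nz0; congr (ereal_inf (EFin @` _)); apply/seteqP; split=> t [t0 Nt].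
  by split; [exact: ltW|exact: Nt].
split; last exact: Nt.
by rewrite lt_neqAle t0 andbT; apply/eqP => t0'; apply: Nz0; rewrite t0'.
Qed.

(** During the last [e / C] units of time before [h] the distance is below [e]; [0 < h] makes some
    of these times positive. *)
Lemma liminf_dist_hit T z (h : R) : closed T -> loc_lipschitz z ->
  hit_time T z = h%:E -> 0 < h ->
  limf_einf (fun t => dist T (z t)) (left_filter (hit_time T z)) = 0%E.
Proof.
move=> cT zlip hE h0.
apply: (limf_einf_eq0P (left_filter_proper _) (fun t => dist_ge0 T (z t))).2 => e V e0.
rewrite hE/= => FV; have [_ Th] := hit_time_attained cT zlip hE.
have [C C0 zC] := zlip h.
have : \forall t \near h^'-, [/\ V t, 0 < t, h - e / C < t & t < h].
  near=> t; split; near: t => //.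
  - exact: nbhs_left_gt.
  - by apply: nbhs_left_gt; rewrite ltrBlDr ltrDl divr_gt0.
  - exact: nbhs_left_lt.
move=> /(@filter_ex _ _ (at_left_proper_filter h))[t [Vt t0 te th]]; exists t => //.
apply: (le_lt_trans (dist_le _ Th)); rewrite lte_fin.
apply: (le_lt_trans (zC _ _ _ _)); rewrite ?lexx ?ltW//= ?(ltW th)//.
rewrite distrC ger0_norm ?subr_ge0 ?(ltW th)// -ltr_pdivlMl// mulrC.
by move: te; lra.
Unshelve. all: by end_near. Qed.

End target.

(** * The value function *)

Lemma left_filter_shift {R : realType} (c : R) (h : \bar R) (V : set R) :
  left_filter (h + c%:E)%E V -> left_filter h (shift c @^-1` V).
Proof.
case: h => [h| |] /=.
- move=> /nbhs_ballP[e /= e0 He]; apply/nbhs_ballP; exists e => //= t.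
  rewrite -ball_normE/= => ht th; apply: He; last by rewrite /shift ltrD2r.
  by rewrite -ball_normE/= /shift opprD addrACA subrr addr0.
- move=> [N [Nr HN]]; exists (N - c); split; first exact: num_real.
  by move=> t; rewrite ltrBlDr; exact: HN.
- move=> [N [Nr HN]]; exists (N - c); split; first exact: num_real.
  by move=> t; rewrite ltrBrDr; exact: HN.
Qed.

Lemma left_filter_gt {R : realType} (c : R) (h : \bar R) :
  (c%:E < h)%E -> left_filter h [set t | c < t].
Proof.
case: h => [h| |] //=; first by rewrite lte_fin; exact: nbhs_left_gt.
by move=> _; exists c; split => //; exact: num_real.
Qed.

Section hit_domain.
Context {R : realType}.

(** Convertible with the integration domain of [cost], and handles finite and infinite hitting times
    alike. *)
Definition hit_domain (h : \bar R) : set (lebesgueR R) :=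
  [set t : R | 0 <= t /\ (t%:E < h)%E].

Lemma measurable_hit_domain h : measurable (hit_domain h).
Proof.
case: h => [h| |].
- have -> : hit_domain h%:E = `[0, h[%classic.
    by apply/seteqP; split=> t; rewrite /hit_domain /= in_itv/= lte_fin => /andP.
  exact: measurable_leb_itv.
- have -> : hit_domain +oo = `[0, +oo[%classic.
    apply/seteqP; split=> t; rewrite /hit_domain /= in_itv/= andbT ?ltry//.
    by case.
  exact: measurable_leb_itv.
- have -> // : hit_domain -oo = set0.
  by apply/seteqP; split=> t //; rewrite /hit_domain /= ltNge leNye => -[].
Qed.

Lemma hit_domain_sub h : hit_domain h `<=` `[0, +oo[%classic.
Proof. by move=> t [t0 _]; rewrite /= in_itv/= t0. Qed.

Lemma itvco_sub_hit_domain (c : R) h : (c%:E <= h)%E ->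
  `[0, c[%classic `<=` hit_domain h.
Proof.
move=> ch t; rewrite /= in_itv/= => /andP[t0 tc]; split=> //.
by apply: lt_le_trans ch; rewrite lte_fin.
Qed.

End hit_domain.

Section control_system.
Context {R : realType} {n m : nat}.
Variables (T : set 'rV[R]_n) (A : set 'rV[R]_m).
Variables (f : 'rV[R]_n -> 'rV[R]_m -> 'rV[R]_n) (l : 'rV[R]_n -> 'rV[R]_m -> R).
Variables (y : 'rV[R]_n -> (R -> 'rV[R]_m) -> R -> 'rV[R]_n) (M : R).
Hypothesis hT : closed T.
Hypothesis hl : {within [set p : 'rV[R]_n * 'rV[R]_m | A p.2],
           continuous (fun p => l p.1 p.2)}.
Hypothesis hl0 : forall x v, A v -> 0 <= l x v.
Hypothesis hM : 0 < M.
Hypothesis hgrowth : forall x v, A v -> enorm (f x v) <= M * (1 + enorm x).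
Hypothesis hlip : forall Rad : R, 0 < Rad -> exists2 L : R, 0 < L &
     forall x1 x2 v, enorm x1 <= Rad -> enorm x2 <= Rad -> A v ->
       enorm (f x1 v - f x2 v) <= L * enorm (x1 - x2) /\
       `|l x1 v - l x2 v| <= L * enorm (x1 - x2).
Hypothesis hy : forall x a, control A a -> is_solution f x a (y x a).

Let hlipf : forall Rad : R, 0 < Rad -> exists2 L : R, 0 < L &
     forall x1 x2 v, enorm x1 <= Rad -> enorm x2 <= Rad -> A v ->
       enorm (f x1 v - f x2 v) <= L * enorm (x1 - x2).
Proof.
move=> Rad /hlip[L L0 HL]; exists L => // x1 x2 v h1 h2 h3.
by case: (HL x1 x2 v h1 h2 h3).
Qed.

Let hlipl : forall Rad : R, 0 < Rad -> exists2 L : R, 0 < L &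
     forall x1 x2 v, enorm x1 <= Rad -> enorm x2 <= Rad -> A v ->
       `|l x1 v - l x2 v| <= L * enorm (x1 - x2).
Proof.
move=> Rad /hlip[L L0 HL]; exists L => // x1 x2 v h1 h2 h3.
by case: (HL x1 x2 v h1 h2 h3).
Qed.

Lemma traj_flow x a : control A a -> flow f (y x a) a.
Proof. by move=> ca; exact: is_solution_flow (hy x ca). Qed.

Lemma traj0 x a : control A a -> y x a 0 = x.
Proof. by move=> ca; exact: is_solution_init (hy x ca). Qed.

Lemma traj_loc_lipschitz x a : control A a -> loc_lipschitz (y x a).
Proof. by move=> ca tau; have := flow_lipschitz hM hgrowth tau (traj_flow x ca) ca.1. Qed.

Lemma measurable_traj_cost x a : control A a ->
  @measurable_fun _ _ (lebesgueR R) _ `[0, +oo[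
    (fun s : lebesgueR R => (l (y x a s) (a s))%:E).
Proof.
move=> ca; apply/measurable_EFinP.
apply: (measurable_running_cost hl ca hlipl) => tau.
  by have := flow_enorm_bounded hM hgrowth tau (traj_flow x ca) ca.1.
exact: traj_loc_lipschitz.
Qed.

Lemma cost_ge0 x a : control A a -> (0 <= cost T l y x a)%E.
Proof.
by move=> ca; apply: integral_ge0 => t [t0 _]; rewrite lee_fin hl0//; exact: ca.1.
Qed.

Lemma value_ge0 x : (0 <= value T A l y x)%E.
Proof.
rewrite /value; case: ifPn => // _; apply: le_ereal_inf_tmp => _ [a [ca _] <-].
exact: cost_ge0.
Qed.

Lemma value_le_cost x a : admissible T A y x a -> ~ T x ->
  (value T A l y x <= cost T l y x a)%E.
Proof.
move=> aa Tx; rewrite /value; case: ifPn => [/set_mem//|_].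
by apply: ereal_inf_lbound; exists a.
Qed.

Lemma value_target x : T x -> value T A l y x = 0%E.
Proof. by move=> Tx; rewrite /value mem_set. Qed.

Lemma value_lt_admissible x v : ~ T x -> (value T A l y x < v)%E ->
  exists2 a, admissible T A y x a & (cost T l y x a < v)%E.
Proof.
move=> Tx; rewrite /value; case: ifPn => [/set_mem//|_].
by move=> /ereal_inf_lt[_ [a aa <-] ?]; exists a.
Qed.

Lemma traj_concat_before x a b (c t : R) : 0 <= c -> control A a -> control A b ->
  0 <= t <= c -> y x (concat c a b) t = y x a t.
Proof.
move=> c0 ca cb; have cg := control_concat c0 ca cb.
apply: (flow_unique hM hgrowth hlipf (traj_flow x cg) (traj_flow x ca) cg.1 ca.1).
  by move=> r /andP[_ rc]; rewrite /concat rc.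
by rewrite !traj0.
Qed.

(** After a shift by [c] the trajectory solves the equation for [b] from [y x a c], so uniqueness
    applies. *)
Lemma traj_concat_after x a b (c t : R) : 0 <= c -> control A a -> control A b ->
  0 <= t -> y x (concat c a b) (t + c) = y (y x a c) b t.
Proof.
move=> c0 ca cb t0; have cg := control_concat c0 ca cb.
have gb r : 0 < r -> (concat c a b \o shift c) r = b r.
  by move=> r0; rewrite /concat /shift/= leNgt ltrDr r0/= addrK.
have Fg := flow_eq_control gb (flow_shift c0 (traj_flow x cg)).
rewrite -[LHS]/((y x (concat c a b) \o shift c) t).
apply: (flow_unique hM hgrowth hlipf Fg (traj_flow _ cb) cb.1 cb.1 _ _ (tau := t)) => //.
  by rewrite traj0//= /shift add0r traj_concat_before// c0 lexx.
by rewrite t0 lexx.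
Qed.

(** There is no hit up to [c], so hits of the concatenation are hits of the second trajectory
    delayed by [c]. One inequality uses that a finite hitting time is attained. *)
Lemma hit_time_concat x a b (c : R) : 0 <= c -> control A a -> control A b ->
  (forall t, 0 <= t <= c -> ~ T (y x a t)) ->
  hit_time T (y x (concat c a b)) = (hit_time T (y (y x a c) b) + c%:E)%E.
Proof.
move=> c0 ca cb nT; apply/eqP; rewrite eq_le; apply/andP; split.
  have := hit_time_ge0 T (y (y x a c) b).
  case hE : (hit_time T (y (y x a c) b)) => [h| |] // _; last by rewrite addye ?leey.
  have [h0 Th] := hit_time_attained hT (traj_loc_lipschitz _ cb) hE.
  apply: hit_time_le; first exact: addr_ge0.
  by rewrite traj_concat_after.
apply: le_ereal_inf_tmp => _ [t [t0 Tt] <-].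
have [tc|ct] := leP t c.
  by exfalso; apply: (nT t); rewrite ?t0 ?tc// -(@traj_concat_before x a b c)// t0.
have tc0 : 0 <= t - c by rewrite subr_ge0 ltW.
have : (hit_time T (y (y x a c) b) <= (t - c)%:E)%E.
  by apply: hit_time_le => //; rewrite -traj_concat_after// subrK.
by rewrite EFinB leeBrDr.
Qed.

(** The lower limit is carried over by the shift. The second hitting time is positive, so the
    sampled times can be taken positive, where the shifted trajectory is known. *)
Lemma admissible_concat x a b (c : R) : 0 <= c -> control A a ->
  admissible T A y (y x a c) b ->
  (forall t, 0 <= t <= c -> ~ T (y x a t)) ->
  admissible T A y x (concat c a b).
Proof.
move=> c0 ca [cb lb] nT; split; first exact: control_concat.
apply: (limf_einf_eq0P (left_filter_proper _) (fun t => dist_ge0 T _)).2 => e V e0.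
rewrite hit_time_concat// => /left_filter_shift FV.
have H0 : (0 < hit_time T (y (y x a c) b))%E.
  apply: hit_time_gt0 => //; first exact: traj_loc_lipschitz.
  by rewrite traj0//; apply: nT; rewrite c0 lexx.
have FF := left_filter_proper (hit_time T (y (y x a c) b)).
have [t [Vt t0] dt] := (limf_einf_eq0P FF (fun t => dist_ge0 T _)).1 lb e _ e0
  (@filterI _ _ FF _ _ FV (left_filter_gt H0)).
exists (t + c) => //.
by rewrite traj_concat_after// ltW.
Qed.

Lemma admissible_hit x a (h : R) : control A a ->
  hit_time T (y x a) = h%:E -> ~ T x -> admissible T A y x a.
Proof.
move=> ca hE Tx; split=> //.
apply: (liminf_dist_hit hT (traj_loc_lipschitz x ca) hE).
by rewrite -lte_fin -hE hit_time_gt0//; [exact: traj_loc_lipschitz|rewrite traj0].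
Qed.

Lemma cost_concat_le x a b (c : R) : 0 <= c -> control A a -> control A b ->
  (forall t, 0 <= t <= c -> ~ T (y x a t)) ->
  (cost T l y x (concat c a b) <=
   \int[leb]_(t in (`[0%R, c[%classic : set (lebesgueR R))) (l (y x a t) (a t))%:E
   + cost T l y (y x a c) b)%E.
Proof.
move=> c0 ca cb nT; have cg := control_concat c0 ca cb.
pose g := fun t : lebesgueR R => (l (y x (concat c a b) t) (concat c a b t))%:E.
pose gb := fun t : lebesgueR R => (l (y (y x a c) b t) (b t))%:E.
pose H := hit_time T (y (y x a c) b).
(* Time 0 is removed because the concatenation follows [b] only strictly after [c]; the instant [c]
   itself goes into the null set [J]. *)
pose Q : set (lebesgueR R) := hit_domain H `&` `]0, +oo[%classic.
pose P : set (lebesgueR R) := shift (- c) @^-1` Q.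
pose I : set (lebesgueR R) := `[0, c[%classic.
pose J : set (lebesgueR R) := `[c, c]%classic.
have mI : measurable I := measurable_leb_itv _.
have mJ : measurable J := measurable_leb_itv _.
have mH := measurable_hit_domain H.
have mHc := measurable_hit_domain (H + c%:E)%E.
have mQ : measurable Q := measurableI _ _ mH (measurable_leb_itv _).
have mP : measurable P by exact: caratheodory_shift mQ.
have mIJ : measurable (I `|` J) := measurableU _ _ mI mJ.
have mU : measurable ((I `|` J) `|` P) := measurableU _ _ mIJ mP.
have m0 := measurable_leb_itv (`[0, +oo[ : interval R).
have Pc t : P t -> c < t.
  by move=> [_]; rewrite /shift/= in_itv/= andbT subr_gt0.
have U0 : (I `|` J) `|` P `<=` `[0, +oo[%classic.
  move=> t [[|]|/Pc ct]; rewrite ?/I ?/J /= in_itv/= ?in_itv/= ?andbT.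
  - by case/andP.
  - by case/andP => + _; exact: le_trans.
  - by rewrite (le_trans c0)// ltW.
have mg := measurable_traj_cost x cg.
have mgb := measurable_traj_cost (y x a c) cb.
have g0 t : `[0, +oo[%classic t -> (0 <= g t)%E.
  by rewrite /= in_itv/= andbT => t0; rewrite lee_fin hl0//; exact: cg.1.
have gb0 t : `[0, +oo[%classic t -> (0 <= gb t)%E.
  by rewrite /= in_itv/= andbT => t0; rewrite lee_fin hl0//; exact: cb.1.
have sub : hit_domain (H + c%:E)%E `<=` (I `|` J) `|` P.
  move=> t [t0 tH]; have [tc|ct|tc] := ltgtP t c.
  - by left; left; rewrite /I/= in_itv/= t0.
  - right; split; last by rewrite /shift/= in_itv/= andbT subr_gt0.
    by split; rewrite /shift/= ?subr_ge0 ?(ltW ct)// EFinB lteBlDr.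
  - by left; right; rewrite /J/= in_itv/= tc lexx.
have dIJ : [disjoint I & J].
  rewrite disj_set2E; apply/eqP; rewrite -subset0 => t []; rewrite /I /J /= !in_itv/=.
  by move=> /andP[_ tc] /andP[+ _]; rewrite leNgt tc.
have dIJP : [disjoint I `|` J & P].
  rewrite disj_set2E; apply/eqP; rewrite -subset0 => t [+ /Pc ct].
  rewrite /I /J /= => -[]; rewrite !in_itv/= => /andP[_].
    by rewrite ltNge ltW.
  by rewrite leNgt ct.
have IJU : I `|` J `<=` `[0, +oo[%classic := subset_trans (@subsetUl _ _ _) U0.
have IE : (\int[leb]_(t in I) g t = \int[leb]_(t in I) (l (y x a t) (a t))%:E)%E.
  apply: eq_integral => t; rewrite inE /I /= in_itv/= => /andP[t0 tc].
  by rewrite /g traj_concat_before ?t0 ?(ltW tc)// /concat (ltW tc).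
have JE : (\int[leb]_(t in J) g t = 0)%E.
  have J0 : leb J = 0%E by rewrite /J (leb_itv true false (lexx c)) subrr.
  by apply: (null_set_integral mJ _ J0); apply: measurable_funS mg => // t Jt;
    apply: IJU; right.
have PE : (\int[leb]_(t in P) g t <= cost T l y (y x a c) b)%E.
  have -> : (\int[leb]_(t in P) g t = \int[leb]_(t in Q) gb t)%E.
    rewrite (@ge0_integral_shift _ (- c) Q gb mQ).
    - apply: eq_integral => t; rewrite inE => /Pc ct.
      rewrite /g /gb -{1}(subrK c t) traj_concat_after ?subr_ge0 ?(ltW ct)//.
      by rewrite /concat leNgt ct.
    - by apply: measurable_funS mgb => // t [/hit_domain_sub].
    - by move=> t [/hit_domain_sub]; move=> /gb0.
  rewrite -[leRHS]/(\int[leb]_(t in hit_domain H) gb t)%E.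
  apply: (ge0_subset_integral leb mQ mH).
  - by apply: measurable_funS mgb => //; exact: hit_domain_sub.
  - by move=> t /hit_domain_sub/gb0.
  - by move=> t [].
rewrite {1}/cost hit_time_concat//.
rewrite -[leLHS]/(\int[leb]_(t in hit_domain (H + c%:E)) g t)%E.
apply: (@le_trans _ _ (\int[leb]_(t in (I `|` J) `|` P) g t)%E).
  apply: (ge0_subset_integral leb mHc mU) => //.
  - exact: measurable_funS mg.
  - by move=> t /U0/g0.
rewrite (ge0_integral_setU leb mIJ mP)//.
- rewrite (ge0_integral_setU leb mI mJ)//.
  + by rewrite IE JE adde0 leeD2l.
  + exact: measurable_funS mg.
  + by move=> t /IJU/g0.
- exact: measurable_funS mg.
- by move=> t /U0/g0.
Qed.

(** The trajectory of [x1] has not hit [T] before [s] and [l] is nonnegative, so its cost up to [s]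
    is at most its total cost. *)
Lemma cost_compare x1 x2 a (s B : R) : control A a -> 0 <= s ->
  (s%:E <= hit_time T (y x1 a))%E ->
  (forall t, 0 <= t <= s -> `|l (y x2 a t) (a t) - l (y x1 a t) (a t)| <= B) ->
  (\int[leb]_(t in (`[0%R, s[%classic : set (lebesgueR R))) (l (y x2 a t) (a t))%:E
   <= cost T l y x1 a + (B * s)%:E)%E.
Proof.
move=> ca s0 sh lB.
have B0 : 0 <= B by apply: le_trans (lB 0 _); rewrite ?normr_ge0// lexx s0.
pose I : set (lebesgueR R) := `[0, s[%classic.
have mI : measurable I := measurable_leb_itv _.
have mH := measurable_hit_domain (hit_time T (y x1 a)).
have m0 := measurable_leb_itv (`[0, +oo[ : interval R).
have IH : I `<=` hit_domain (hit_time T (y x1 a)) := itvco_sub_hit_domain sh.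
have I0 : I `<=` `[0, +oo[%classic := subset_trans IH (@hit_domain_sub _ _).
have l0 x t : `[0, +oo[%classic t -> (0 <= (l (y x a t) (a t))%:E)%E.
  by rewrite /= in_itv/= andbT => t0; rewrite lee_fin hl0//; exact: ca.1.
have ml x : @measurable_fun _ _ (lebesgueR R) _ I
    (fun t : lebesgueR R => (l (y x a t) (a t))%:E).
  exact: measurable_funS (measurable_traj_cost x ca).
have I1 t : I t -> (0 <= (l (y x1 a t) (a t))%:E)%E by move=> /I0; exact: l0.
have I2 t : I t -> (0 <= (l (y x2 a t) (a t))%:E)%E by move=> /I0; exact: l0.
have IB t : I t -> (0 <= B%:E)%E by rewrite lee_fin.
have mB : @measurable_fun _ _ (lebesgueR R) _ I (fun=> B%:E) by exact: measurable_cst.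
have le12 t : I t ->
    ((l (y x2 a t) (a t))%:E <= (l (y x1 a t) (a t))%:E + B%:E)%E.
  rewrite /I/= in_itv/= => /andP[t0 ts].
  rewrite -EFinD lee_fin -lerBlDl (le_trans (ler_norm _))// lB//.
  by rewrite t0 ltW.
apply: (le_trans (ge0_le_integral leb mI I2 (ml x2) (emeasurable_funD (ml x1) mB) le12)).
rewrite (ge0_integralD leb mI I1 (ml x1) IB mB).
apply: leeD.
  rewrite -[leRHS]/(\int[leb]_(t in hit_domain (hit_time T (y x1 a)))
    (l (y x1 a t) (a t))%:E)%E.
  apply: (ge0_subset_integral leb mI mH).
  - exact: (measurable_funS m0 (@hit_domain_sub _ _) (measurable_traj_cost x1 ca)).
  - by move=> t /hit_domain_sub; exact: l0.
  - exact: IH.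
have muI : leb I = s%:E by rewrite /I (leb_itv true true s0) subr0.
by rewrite integral_cst// [X in (_ * X)%E]muI.
Qed.

(** * The local estimate on the value function and its two consequences *)

Hypothesis hbT : compact (boundary T).
Hypothesis hTPC : TPC T A l y.
Hypothesis hcont : forall x, boundary T x -> value_continuous_at T A l y x.

(** [L] and [P] are uniform in the control and in the starting points: the growth bound encloses all
    trajectories from the unit ball around [xbar] in one ball of radius [B], whose Lipschitz
    constant then enters Grönwall. *)
Lemma close_trajectories (xbar : 'rV[R]_n) (tau : R) : 0 <= tau ->
  exists L P : R, [/\ 0 < L, 0 < P & forall x1 x2 a t (r : R), r <= 1 ->
    control A a -> `|xbar - x1| < r -> `|xbar - x2| < r -> 0 <= t <= tau ->
    enorm (y x1 a t - y x2 a t) <= P * r /\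
    `|l (y x1 a t) (a t) - l (y x2 a t) (a t)| <= L * (P * r)].
Proof.
move=> tau0; have [k1 kt1] := archi_half (n%:R * M * tau).
pose X := n%:R * (`|xbar| + 1); pose B := 2 ^+ k1 * (1 + X).
have X0 : 0 <= X by rewrite mulr_ge0// addr_ge0.
have B0 : 0 < B by rewrite mulr_gt0 ?exprn_gt0// ltr_pwDl.
have [L L0 HL] := hlip B0.
have [k2 kt2] := archi_half (n%:R * L * tau).
(* [2 ^+ k2] comes from Grönwall, [n.+1] from passing from the sup norm to [l1norm] while staying
   positive, and 2 from [|x1 - x2| <= 2 * r]. *)
exists L, (2 ^+ k2 * (n.+1%:R * 2)); split; [exact: L0|by rewrite !mulr_gt0 ?exprn_gt0//|].
move=> x1 x2 a t r r1 ca xx1 xx2 /andP[t0 tt].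
have yB x s : `|xbar - x| < r -> 0 <= s <= tau -> enorm (y x a s) <= B.
  move=> xx /andP[s0 st]; apply: (@le_trans _ _ (1 + l1norm (y x a s))).
    by rewrite (le_trans (enorm_le_l1norm _))// lerDr.
  have := flow_growth hM hgrowth (k := k1) (traj_flow x ca) ca.1 s0 _.
  rewrite traj0// => H; apply: (le_trans (H _)).
    by rewrite (le_trans _ kt1)// ler_wpM2l// mulr_ge0// ltW.
  rewrite ler_wpM2l ?exprn_ge0// lerD2l (le_trans (l1norm_le_norm _))// ler_wpM2l//.
  rewrite -[x in `|x|](subKr xbar) (le_trans (ler_normB _ _))// lerD2l.
  by rewrite (le_trans (ltW xx)).
have lipf x3 x4 v : enorm x3 <= B -> enorm x4 <= B -> A v ->
    enorm (f x3 v - f x4 v) <= L * enorm (x3 - x4).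
  by move=> h3 h4 Av; case: (HL x3 x4 v h3 h4 Av).
have ye : enorm (y x1 a t - y x2 a t) <= 2 ^+ k2 * (n.+1%:R * 2) * r.
  apply: (le_trans (enorm_le_l1norm _)).
  have H := flow_stable (k := k2) (t := t) lipf (ltW L0)
    (traj_flow x1 ca) (traj_flow x2 ca) ca.1 (fun _ _ => erefl).
  apply: (le_trans (H _ t0 _)).
  - by move=> s /andP[s0 st]; split; apply: yB => //; rewrite s0 (le_trans st).
  - by rewrite (le_trans _ kt2)// ler_wpM2l// mulr_ge0// ltW.
  - rewrite !traj0// -!mulrA ler_wpM2l ?exprn_ge0//.
    rewrite (le_trans (l1norm_le_norm _))// ler_pM// ?ler_nat//.
    rewrite -[x1 - x2](subrKA xbar) (le_trans (ler_normD _ _))// mulr_natl mulr2n.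
    by rewrite lerD// ltW// distrC.
split=> //.
have [//||_ H] := HL (y x1 a t) (y x2 a t) (a t) _ _ (ca.1 _ t0).
- by apply: yB => //; rewrite t0.
- by apply: yB => //; rewrite t0.
- by apply: (le_trans H); rewrite ler_wpM2l// ltW.
Qed.

(** Only the value at [x1] is bounded beforehand; finiteness at [x2] is part of the conclusion. This
    asymmetry serves both continuity and blow-up. *)
Lemma value_le_near (xbar : 'rV[R]_n) (K eps : R) : ~ T xbar -> 0 <= K -> 0 < eps ->
  exists2 r : R, 0 < r & forall x1 x2, `|xbar - x1| < r -> `|xbar - x2| < r ->
    (value T A l y x1 <= K%:E)%E ->
    (value T A l y x2 <= value T A l y x1 + eps%:E)%E.
Proof.
move=> Txbar K0 eps0.
have [e0 e0_gt0 avoid] := closed_avoid hT Txbar.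
(* With an empty target no control is admissible, so no value is at most [K] off [T]. *)
have [[w0 Tw0]|noT] := pselect (exists w, T w); last first.
  exists e0 => // x1 x2 xx1 _ V1; exfalso.
  have Tx1 : ~ T x1 by exact: avoid.
  have [||a [ca la] _] := @value_lt_admissible x1 (K + 1)%:E.
  - by [].
  - by apply: (le_lt_trans V1); rewrite lte_fin ltrDl.
  have FF := left_filter_proper (hit_time T (y x1 a)).
  have [t _ /dist_lt[w Tw _]] := (limf_einf_eq0P FF (fun t => dist_ge0 T _)).1 la 1 setT
    ltr01 (@filterT _ _ FF).
  by apply: noT; exists w.
(* A quarter of [eps] pays for near optimality, a quarter for the difference of running costs, and
   half for the final stretch, where the value is at most [eps / 4]. *)
have eps4 : 0 < eps / 4 by rewrite divr_gt0.
have [D D0 HD] := small_near_boundary hT hbT value_target hcont eps4.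
(* By [nbhd_near] the neighbourhood has reach [2 * delta]. The bound [e0 / 4] leaves [x1] outside
   it, and [D / 4] leaves room for a gap [D / 4] between the trajectories. *)
pose delta := Num.min (e0 / 4) (D / 4).
have delta0 : 0 < delta by rewrite lt_min !divr_gt0.
have de0 : delta <= e0 / 4 by rewrite ge_min lexx.
have dD : delta <= D / 4 by rewrite ge_min lexx orbT.
pose Rad := n%:R * (`|xbar - w0| + 1) + 1.
have Rad0 : 0 < Rad by rewrite ltr_wpDl// mulr_ge0// addr_ge0.
have [tau [tau0 taule Htau]] := hTPC Rad0 eps4 delta0.
have [L [P [L0 P0 HLP]]] := close_trajectories xbar (tau0 K K0).
pose Tm := tau K.
have Tm1 : 0 < Tm + 1 by rewrite ltr_wpDl// tau0.
(* [S] is the allowed gap between trajectories: [D / 4] for the endpoints, the other bound for the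
   costs. [Tm + 1] avoids a division by zero when [Tm = 0]. *)
pose S := Num.min (D / 4) (eps / 4 / (L * (Tm + 1))).
have S0 : 0 < S by rewrite lt_min !divr_gt0// mulr_gt0.
pose r := Num.min 1 (Num.min (e0 / 2) (S / P)).
have r0 : 0 < r by rewrite !lt_min ltr01 !divr_gt0.
have r1 : r <= 1 by rewrite ge_min lexx.
have re0 : r <= e0 / 2 by rewrite !ge_min lexx !orbT.
have PrS : P * r <= S.
  by rewrite -ler_pdivlMl// mulrC /r !ge_min lexx !orbT.
have PrD : P * r <= D / 4 by rewrite (le_trans PrS)// ge_min lexx.
have Preps : L * (P * r) * Tm <= eps / 4.
  apply: (@le_trans _ _ (L * S * (Tm + 1))).
    rewrite ler_pM ?tau0 ?mulr_ge0 ?(ltW L0) ?(ltW P0) ?(ltW r0)//.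
      by rewrite ler_wpM2l// ltW.
    by rewrite lerDl.
  have : S <= eps / 4 / (L * (Tm + 1)) by rewrite ge_min lexx orbT.
  by rewrite ler_pdivlMr ?mulr_gt0//; lra.
exists r => // x1 x2 xx1 xx2 V1.
have re : r < e0 by rewrite (le_lt_trans re0)// ltr_pdivrMr// ltr_pMr// ltrDl.
have Tx1 : ~ T x1 by apply: avoid; exact: lt_trans re.
have Tx2 : ~ T x2 by apply: avoid; exact: lt_trans re.
have V1fin : (value T A l y x1 < +oo)%E by rewrite (le_lt_trans V1)// ltry.
have Dx1 : Dom T A l y x1 by split=> //; exact: notin_outside.
have Nx1 : ~ nbhd T delta x1.
  move=> /(nbhd_near delta0)[w Tw x1w]; apply: (avoid w) => //.
  rewrite -(subrKA x1) (le_lt_trans (ler_normD _ _))//.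
  by move: x1w xx1; rewrite mulr2n; lra.
have dx1 : (dist T x1 <= Rad%:E)%E.
  apply: (le_trans (dist_le x1 Tw0)); rewrite lee_fin.
  apply: (le_trans (enorm_le_l1norm _)); apply: (le_trans (l1norm_le_norm _)).
  apply: (@le_trans _ _ (n%:R * (`|xbar - w0| + 1))); last by rewrite lerDl.
  rewrite ler_wpM2l// -(subrKA xbar) (le_trans (ler_normD _ _))// addrC lerD2l.
  by rewrite distrC (le_trans (ltW xx1)).
have [a [aa ca1 ta]] := Htau x1 Nx1 Dx1 dx1.
have ca := aa.1.
have V1K : fine (value T A l y x1) <= K.
  by rewrite -lee_fin fineK// ge0_fin_numE// value_ge0.
(* Monotonicity of [tau] gives the time bound [Tm], independent of [x1]. *)
have : (nbhd_time T delta (y x1 a) <= Tm%:E)%E.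
  apply: (le_trans ta); rewrite lee_fin; apply: taule => //.
  exact/fine_ge0/value_ge0.
rewrite nbhd_time_hit_time ?traj0// => tTm.
have [c cE] : exists c, hit_time (nbhd T delta) (y x1 a) = c%:E.
  exists (fine (hit_time (nbhd T delta) (y x1 a))).
  by rewrite fineK// ge0_fin_numE ?hit_time_ge0// (le_lt_trans tTm)// ltry.
have [c0 Nc] := hit_time_attained (@closed_nbhd _ _ T delta) (traj_loc_lipschitz x1 ca) cE.
have cTm : c <= Tm by rewrite -lee_fin -cE.
have c_hit : (c%:E <= hit_time T (y x1 a))%E.
  rewrite -cE; apply: le_ereal_inf_tmp => _ [t [t0 Tt] <-].
  exact: (@hit_time_le _ _ _ (y x1 a) t t0 (sub_nbhd delta0 Tt)).
have lclose t : 0 <= t <= c ->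
    `|l (y x2 a t) (a t) - l (y x1 a t) (a t)| <= L * (P * r).
  move=> /andP[t0 tc]; have [] // := HLP x2 x1 a t r r1 ca xx2 xx1.
  by rewrite t0 (le_trans tc).
have Bs s : s <= c -> L * (P * r) * s <= eps / 4.
  move=> sc; apply: le_trans Preps; rewrite ler_wpM2l ?(le_trans sc)//.
  by rewrite mulr_ge0 ?mulr_ge0// ltW.
have cost_upto s : 0 <= s -> s <= c ->
  (\int[leb]_(t in (`[0%R, s[%classic : set (lebesgueR R))) (l (y x2 a t) (a t))%:E
   <= value T A l y x1 + (eps / 4 + eps / 4)%:E)%E.
  move=> s0 sc; apply: (@le_trans _ _ (cost T l y x1 a + (L * (P * r) * s)%:E)%E).
    apply: cost_compare => //.
      by apply: le_trans c_hit; rewrite lee_fin.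
    by move=> t /andP[t0 ts]; apply: lclose; rewrite t0 (le_trans ts).
  by rewrite EFinD addeA leeD// lee_fin Bs.
(* If the second trajectory hits [T] by time [c], then [a] itself is admissible for [x2]. Otherwise
   [a] is followed up to [c] and continued by a cheap control from there. *)
have [[t [/andP[t0 tc] Tt]]|nohit] := pselect (exists t, 0 <= t <= c /\ T (y x2 a t)).
  have ht := @hit_time_le _ _ T (y x2 a) t t0 Tt.
  have [h hE] : exists h, hit_time T (y x2 a) = h%:E.
    exists (fine (hit_time T (y x2 a))).
    by rewrite fineK// ge0_fin_numE ?hit_time_ge0// (le_lt_trans ht)// ltry.
  have [h0 Th] := hit_time_attained hT (traj_loc_lipschitz x2 ca) hE.
  have hc : h <= c by apply: le_trans tc; rewrite -lee_fin -hE.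
  apply: (le_trans (value_le_cost (admissible_hit ca hE Tx2) Tx2)).
  have -> : cost T l y x2 a =
     (\int[leb]_(t in (`[0%R, h[%classic : set (lebesgueR R))) (l (y x2 a t) (a t))%:E)%E.
    rewrite /cost hE; congr (integral _ _ _).
    by apply/seteqP; split=> s; rewrite /= in_itv/= lte_fin => /andP.
  apply: (le_trans (cost_upto h h0 hc)); rewrite leeD2l// lee_fin.
  by move: eps0; lra.
have nT t : 0 <= t <= c -> ~ T (y x2 a t).
  by move=> tc Tt; apply: nohit; exists t.
pose w := y x2 a c.
have Tw : ~ T w by apply: nT; rewrite c0 lexx.
have [w' Tw' yw'] := nbhd_near delta0 Nc.
have Vw : (value T A l y w <= (eps / 4)%:E)%E.
  apply: (HD w w') => //; first exact: notin_outside.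
  have [|ye _] := HLP x1 x2 a c r r1 ca xx1 xx2; first by rewrite c0.
  rewrite -(subrKA (y x1 a c)) (le_lt_trans (ler_normD _ _))//.
  have : `|w - y x1 a c| <= D / 4.
    by rewrite distrC (le_trans (norm_le_enorm _))// (le_trans ye).
  by move: yw' dD D0; rewrite mulr2n; lra.
have [|b ab cb] := @value_lt_admissible w (eps / 2)%:E Tw.
  by apply: (le_lt_trans Vw); rewrite lte_fin; move: eps0; lra.
have ag : admissible T A y x2 (concat c a b) by exact: admissible_concat.
apply: (le_trans (value_le_cost ag Tx2)).
apply: (le_trans (cost_concat_le c0 ca ab.1 nT)).
apply: (le_trans (leeD (cost_upto c c0 (lexx _)) (ltW cb))).
rewrite -addeA leeD2l// lee_fin.
by move: eps0; lra.
Qed.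

Lemma value_continuous_Dom x : Dom T A l y x -> value_continuous_at T A l y x.
Proof.
move=> [ox Vx]; have [Tx|Tx] := pselect (T x).
  by apply: hcont; exact: outside_boundary.
have Vfin : value T A l y x \is a fin_num by rewrite ge0_fin_numE// value_ge0.
pose v := fine (value T A l y x).
have vE : value T A l y x = v%:E by rewrite fineK.
have v0 : 0 <= v by exact/fine_ge0/value_ge0.
have near_x e : 0 < e -> \forall x' \near within (outside T) (nbhs x),
    (v%:E <= value T A l y x' + e%:E)%E /\ (value T A l y x' <= v%:E + e%:E)%E.
  (* The level [v + e] bounds the value at [x] and, after the first application, at [x'], so the
     estimate can be used in both directions. *)
  move=> e0; have [r r0 Hr] := value_le_near Tx (addr_ge0 v0 (ltW e0)) e0.
  apply/nbhs_ballP; exists r => //= x' + _; rewrite -ball_normE/= => xx'.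
  have xx : `|x - x| < r by rewrite subrr normr0.
  have Vx' : (value T A l y x' <= v%:E + e%:E)%E.
    by rewrite -vE; apply: Hr; rewrite // vE lee_fin lerDl ltW.
  by split=> //; rewrite -vE; apply: Hr.
rewrite /value_continuous_at vE; apply/fine_cvgP; split.
  apply: filterS (near_x 1 ltr01) => x' [_ Vx'].
  by rewrite ge0_fin_numE ?value_ge0// (le_lt_trans Vx')// -EFinD ltry.
apply/cvgrPdist_le => e e0; apply: filterS (near_x e e0) => x' [] /=.
have := value_ge0 x'; case: (value T A l y x') => [u| |] //= _.
rewrite -!EFinD !lee_fin => h1 h2.
by rewrite ler_norml lerNl opprB !lerBlDl h1 h2.
Qed.

(** Points of infinite value accumulate at [xbar]. So [xbar] is not in [T], where the value is 0 and
    continuous, and a value below [K] near [xbar] would make one of these infinite values finite. *)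
Lemma value_cvgy_rel_boundary xbar : rel_boundary (outside T) (Dom T A l y) xbar ->
  value T A l y x @[x --> within (outside T) (nbhs xbar)] --> +oo%E.
Proof.
move=> [[oxbar _] cl].
have escape (r : R) : 0 < r ->
    exists2 x, `|xbar - x| < r /\ outside T x & value T A l y x = +oo%E.
  move=> r0; have [x [[ox nDx] xx]] := cl _ (nbhsx_ballx xbar r r0).
  exists x; first by move: xx; rewrite -ball_normE.
  by apply/eqP; rewrite -leye_eq leNgt; apply/negP => Vx; apply: nDx.
have Txbar : ~ T xbar.
  move=> Tx; have := hcont (outside_boundary hT Tx oxbar).
  rewrite /value_continuous_at (value_target Tx) => cV.
  have N0 : nbhs (0%E : \bar R) [set v | (v < 1%:E)%E].
    by apply: open_nbhs_nbhs; split; [exact: open_ereal_lt_ereal|rewrite /= lte_fin].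
  have : nbhs xbar [set x | outside T x -> (value T A l y x < 1%:E)%E] := cV _ N0.
  move=> /nbhs_ballP[r /= r0 Hr]; have [x [xx ox] Vx] := escape r r0.
  by have := Hr x; rewrite -ball_normE/= => /(_ xx ox); rewrite Vx.
apply/cvgeyPge => K.
(* [value_le_near] asks for a nonnegative level, hence the absolute value of [K]. *)
have [r r0 Hr] := value_le_near Txbar (normr_ge0 K) ltr01.
apply/nbhs_ballP; exists r => //= x1; rewrite -ball_normE/= => xx1 _.
rewrite leNgt; apply/negP => V1.
have [x2 [xx2 _] V2] := escape r r0.
have V1K : (value T A l y x1 <= `|K|%:E)%E.
  by rewrite (le_trans (ltW V1))// lee_fin ler_norm.
have := Hr x1 x2 xx1 xx2 V1K; rewrite V2 leye_eq => /eqP.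
by move: V1; case: (value T A l y x1).
Qed.

End control_system.

Theorem theorem4p1 (R : realType) (n m : nat)
  (T : set 'rV[R]_n) (A : set 'rV[R]_m)
  (f : 'rV[R]_n -> 'rV[R]_m -> 'rV[R]_n)
  (l : 'rV[R]_n -> 'rV[R]_m -> R)
  (y : 'rV[R]_n -> (R -> 'rV[R]_m) -> R -> 'rV[R]_n) (M : R)
  (hA : compact A)
  (hT : closed T) (hbT : compact (boundary T))
  (hf : {within [set p : 'rV[R]_n * 'rV[R]_m | A p.2],
           continuous (fun p => f p.1 p.2)})
  (hl : {within [set p : 'rV[R]_n * 'rV[R]_m | A p.2],
           continuous (fun p => l p.1 p.2)})
  (hl0 : forall x a, A a -> 0 <= l x a)
  (hM : 0 < M)
  (hgrowth : forall x a, A a -> enorm (f x a) <= M * (1 + enorm x))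
  (hlip : forall Rad : R, 0 < Rad -> exists2 L : R, 0 < L &
     forall x1 x2 a, enorm x1 <= Rad -> enorm x2 <= Rad -> A a ->
       enorm (f x1 a - f x2 a) <= L * enorm (x1 - x2) /\
       `|l x1 a - l x2 a| <= L * enorm (x1 - x2))
  (hy : forall x a, control A a -> is_solution f x a (y x a)) :
  TPC T A l y ->
  (forall x, boundary T x -> value_continuous_at T A l y x) ->
  (forall x, Dom T A l y x -> value_continuous_at T A l y x) /\
  (forall xbar, rel_boundary (outside T) (Dom T A l y) xbar ->
     value T A l y x @[x --> within (outside T) (nbhs xbar)] --> +oo%E).
Proof.
move=> hTPC hcont; split.
  move=> x; exact: (value_continuous_Dom hT hl hl0 hM hgrowth hlip hy hbT hTPC hcont).
move=> x; exact: (value_cvgy_rel_boundary hT hl hl0 hM hgrowth hlip hy hbT hTPC hcont).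
Qed.
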